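(* Consider $\mathcal{M}=(0,\infty)\times\mathbb{R}^3$ with metric $g=-dt\otimes dt+t^2\delta_{ij}dx^i\otimes dx^j$, let $\lambda>0$, $\xi\in\mathbb{R}$. Let $A_\star$ be the Weyl algebra of $(V_\star,\omega_\star)=\big(C_0^\infty(\mathcal{M},\mathbb{R})/P[C_0^\infty(\mathcal{M},\mathbb{R})],\omega_\star\big)$, let $A_{\mathrm{ext}}$ and $A_{\mathrm{ext}\star}$ be the Weyl algebras of $(V_{\mathrm{ext}},\omega)=\big(C^\infty_{0,\mathscr{S}}(\mathcal{M},\mathbb{R})/\mathrm{Ker}(\Delta),\omega\big)$ and of $(V_{\mathrm{ext}\star},\omega_\star)=(V_{\mathrm{ext}},\omega_\star)$, and let $\mathfrak{S}:A_\star\to A_{\mathrm{ext}}$ and its extension $\mathfrak{S}_{\mathrm{ext}}:A_{\mathrm{ext}\star}\to A_{\mathrm{ext}}$ be the injective $\ast$-morphisms sending the Weyl generator of $[\varphi]$ to the Weyl generator of $[S\varphi]$, where $(\widetilde{S}\widetilde{\varphi})(t,k)=\cosh(3\lambda k_1)^{-1/2}\,\widetilde{\varphi}(t,k)$. If $\Omega_{\mathrm{ext}}:A_{\mathrm{ext}}\to\mathbb{C}$ is an $SO(3)\ltimes\mathbb{R}^3$-invariant state, then $\Omega_\star:=\Omega_{\mathrm{ext}}\circ\mathfrak{S}:A_\star\to\mathbb{C}$ is a state on $A_\star$ which is invariant under the unbroken symmetry group $SO(2)\ltimes\mathbb{R}^3$, where the $SO(2)$-rotation preserves the $x^1$-axis.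 The same holds true for $\Omega_{\mathrm{ext}\star}:=\Omega_{\mathrm{ext}}\circ\mathfrak{S}_{\mathrm{ext}}:A_{\mathrm{ext}\star}\to\mathbb{C}$.
   Context: $P=\square_g-\xi\mathfrak{R}$ ($\mathfrak{R}$ the scalar curvature of $g$). The spatial Fourier transform is $\widetilde{\varphi}(t,k)=\int_{\mathbb{R}^3}d^3x\,e^{ikx}\varphi(t,x)$. A function $\varphi\in C^\infty(\mathcal{M})$ is in $C^\infty_{0,\mathscr{S}}(\mathcal{M})$ iff (1.) for every fixed $x\in\mathbb{R}^3$, $\varphi(\cdot,x)\in C_0^\infty((0,\infty))$, and (2.) for every fixed $t\in(0,\infty)$, $\varphi(t,\cdot)\in\mathscr{S}(\mathbb{R}^3)$ is a Schwartz function; $C^\infty_{0,\mathscr{S}}(\mathcal{M},\mathbb{R})$ denotes the real valued such functions. Let $$\widetilde{\Delta}(t,\tau,k)=\frac{t^{s}\tau^{-s}-t^{-s}\tau^{s}}{2t\tau s},\qquad s=\sqrt{1-k^2-6\xi}$$ (with the limiting value at $s=0$), and let $\Delta$ act by $\widetilde{\Delta}(\widetilde{\varphi})(t,k)=-\int_0^\infty d\tau\,\tau^3\,\widetilde{\Delta}(t,\tau,k)\,\widetilde{\varphi}(\tau,k)$; $\mathrm{Ker}(\Delta)$ is its kernel on $C^\infty_{0,\mathscr{S}}(\mathcal{M},\mathbb{R})$. The forms are $$\omega(\varphi,\psi)=-\int_0^\infty dt\,t^3\int_0^\infty d\tau\,\tau^3\int_{\mathbb{R}^3}\frac{d^3k}{(2\pi)^3}\,\widetilde{\varphi}(t,-k)\,\widetilde{\Delta}(t,\tau,k)\,\widetilde{\psi}(\tau,k)$$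 and $\omega_\star$, given by the same formula with $\widetilde{\Delta}(t,\tau,k)$ replaced by $\widetilde{\Delta}(t,\tau,k)/\cosh(3\lambda k_1)$; both are passed to the quotients, where they are symplectic (antisymmetric, weakly nondegenerate). The geometric action of $(R,a)\in SO(3)\ltimes\mathbb{R}^3$ is $(\alpha_{(R,a)}\varphi)(t,x)=\varphi(t,R^{-1}(x-a))$. The Weyl algebra of a real symplectic vector space $(V,\rho)$ is the (unique up to $\ast$-isomorphism) unital $C^\ast$-algebra generated by $W(\varphi)$, $\varphi\in V$, with $W(0)=1$, $W(\varphi)^\ast=W(-\varphi)$, $W(\varphi)W(\psi)=e^{-i\rho(\varphi,\psi)/2}W(\varphi+\psi)$; a symplectic automorphism $\alpha$ acts by the $\ast$-automorphism with $W(\varphi)\mapsto W(\alpha\varphi)$. A state is a normalized positive linear functional; it is invariant under a group if it is invariant under the corresponding $\ast$-automorphisms.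
   Formalization: As Δ and S are undefined on parts of C^∞_{0,𝒮}, V_ext is built from any linear space between C_0^∞ and C^∞_{0,𝒮} that SO(3)⋉R³ and S map to itself and on which Ker(Δ) is a linear subspace, e.g. C_c^∞((0,∞),𝒮(R³)). *)

(* Defs.v *)
From HB Require Import structures.
From mathcomp Require Import all_boot all_order all_algebra.
From mathcomp Require Import complex.
From mathcomp Require Import all_classical all_reals all_analysis.

Set Implicit Arguments.
Unset Strict Implicit.
Unset Printing Implicit Defensive.

Import Order.TTheory GRing.Theory Num.Theory.
Import numFieldNormedType.Exports.

Local Open Scope classical_set_scope.
Local Open Scope quotient_scope.
Local Open Scope complex_scope.
Local Open Scope ring_scope.

(* The norm is R-valued rather than the R[i]-valued norm of a
   [normedModType R[i]]: the hierarchy has no join of rings and normed modules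
   other than the numeric domains.  Completeness is sequential. *)
HB.mixin Record isCStarAlgebra (R : realType) A of GRing.Algebra R[i] A := {
  star : A -> A;
  cnorm : A -> R;
  starK : involutive star;
  starD : forall a b : A, star (a + b) = star a + star b;
  starZ : forall (c : R[i]) (a : A), star (c *: a) = c^*%C *: star a;
  starM : forall a b : A, star (a * b) = star b * star a;
  cnorm_eq0 : forall a : A, cnorm a = 0 -> a = 0;
  cnormD : forall a b : A, cnorm (a + b) <= cnorm a + cnorm b;
  cnormZ : forall (c : R[i]) (a : A), cnorm (c *: a) = complex.Re `|c| * cnorm a;
  cnormM : forall a b : A, cnorm (a * b) <= cnorm a * cnorm b;
  cnorm_starM : forall a : A, cnorm (star a * a) = cnorm a ^+ 2;
  cnorm_complete : forall u : nat -> A,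
    (forall e : R, 0 < e -> exists n0 : nat, forall m n : nat,
       (n0 <= m)%N -> (n0 <= n)%N -> cnorm (u m - u n) < e) ->
    exists l : A, (fun n => cnorm (u n - l)) @ \oo --> (0 : R) }.

#[short(type="cstarAlgType")]
HB.structure Definition CStarAlgebra (R : realType) :=
  {A of isCStarAlgebra R A & GRing.Algebra R[i] A}.

Section QuotientSpace.
Context {K : fieldType} {V : lmodType K} (N : submodClosed V).

Definition quot_equiv (u v : V) := u - v \in N.

Let submodN u : u \in N -> - u \in N.
Proof. by move=> Nu; rewrite -scaleN1r rpredZ. Qed.

Lemma quot_equivP : equiv_class_of quot_equiv.
Proof.
rewrite /quot_equiv; split=> [u|u v|v u w].
- by rewrite subrr rpred0.
- by apply/idP/idP => /submodN; rewrite opprB.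
- by move=> uv vw; rewrite -(subrKA v) rpredD.
Qed.

Canonical quot_equiv_equiv := EquivRelPack quot_equivP.

Definition quot := {eq_quot quot_equiv}.
HB.instance Definition _ : EqQuotient V quot_equiv quot := EqQuotient.on quot.
HB.instance Definition _ := Choice.on quot.

Definition qclass (v : V) : quot := \pi_quot v.

Lemma qclassP u v : qclass u = qclass v <-> u - v \in N.
Proof. by split=> [/eqmodP|uvN]; last exact/eqmodP. Qed.

Lemma qclass_repr (u : quot) : qclass (repr u) = u.
Proof. exact: reprK. Qed.

Definition quot_add (u v : quot) : quot := qclass (repr u + repr v).
Definition quot_opp (u : quot) : quot := qclass (- repr u).
Definition quot_scale (c : K) (u : quot) : quot := qclass (c *: repr u).

Lemma repr_qclass v : repr (qclass v) - v \in N.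
Proof. by apply/qclassP; rewrite qclass_repr. Qed.

Lemma quot_addE u v : quot_add (qclass u) (qclass v) = qclass (u + v).
Proof.
by apply/qclassP; rewrite opprD addrACA rpredD ?repr_qclass.
Qed.

Lemma quot_oppE u : quot_opp (qclass u) = qclass (- u).
Proof. by apply/qclassP; rewrite -opprD submodN ?repr_qclass. Qed.

Lemma quot_scaleE c u : quot_scale c (qclass u) = qclass (c *: u).
Proof. by apply/qclassP; rewrite -scalerBr rpredZ ?repr_qclass. Qed.

Lemma quot_addA : associative quot_add.
Proof.
move=> u v w; rewrite -(qclass_repr u) -(qclass_repr v) -(qclass_repr w).
by rewrite !quot_addE addrA.
Qed.

Lemma quot_addC : commutative quot_add.
Proof. by move=> u v; rewrite /quot_add addrC. Qed.

Lemma quot_add0 : left_id (qclass 0) quot_add.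
Proof. by move=> u; rewrite -(qclass_repr u) quot_addE add0r. Qed.

Lemma quot_addN : left_inverse (qclass 0) quot_opp quot_add.
Proof.
by move=> u; rewrite -(qclass_repr u) quot_oppE quot_addE addNr.
Qed.

HB.instance Definition _ :=
  GRing.isZmodule.Build quot quot_addA quot_addC quot_add0 quot_addN.

Lemma qclassD u v : qclass (u + v) = qclass u + qclass v.
Proof. exact/esym/quot_addE. Qed.

Lemma quot_scaleA a b u : quot_scale a (quot_scale b u) = quot_scale (a * b) u.
Proof. by rewrite -(qclass_repr u) !quot_scaleE scalerA. Qed.

Lemma quot_scale1 : left_id 1 quot_scale.
Proof. by move=> u; rewrite -(qclass_repr u) quot_scaleE scale1r. Qed.

Lemma quot_scaleDr : right_distributive quot_scale +%R.
Proof.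
move=> a u v; rewrite -(qclass_repr u) -(qclass_repr v).
by rewrite -qclassD !quot_scaleE -qclassD scalerDr.
Qed.

Lemma quot_scaleDl u : {morph quot_scale^~ u : a b / a + b}.
Proof.
by move=> a b; rewrite -(qclass_repr u) !quot_scaleE scalerDl qclassD.
Qed.

HB.instance Definition _ := GRing.Zmodule_isLmodule.Build K quot
  quot_scaleA quot_scale1 quot_scaleDr quot_scaleDl.

(* The form induced on the quotient: if rho descends to the quotient, then
   [quot_form rho (qclass u) (qclass v) = rho u v]. *)
Definition quot_form (rho : V -> V -> K) (u v : quot) : K :=
  rho (repr u) (repr v).

End QuotientSpace.

Section ComplexValued.
Context {R : realType}.

Definition cexp (z : R[i]) : R[i] :=
  (expR (complex.Re z))%:C *
  (cos (complex.Im z) +i* sin (complex.Im z)).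

Definition cosh (x : R) : R := (expR x + expR (- x)) / 2.

Definition cpow (t : R) (s : R[i]) : R[i] := cexp (s * (ln t)%:C).

Definition Cintegral d (T : measurableType d) (mu : {measure set T -> \bar R})
    (D : set T) (f : T -> R[i]) : R[i] :=
  (\int[mu]_(x in D) complex.Re (f x)) +i* (\int[mu]_(x in D) complex.Im (f x)).

Definition integral_pos (f : R -> R[i]) : R[i] :=
  Cintegral (@lebesgue_measure R) `]0, +oo[ f.

Definition vec3 (y : R * R * R) : 'cV[R]_3 :=
  \col_i [:: y.1.1; y.1.2; y.2]`_i.

Definition integral_R3 (f : 'cV[R]_3 -> R[i]) : R[i] :=
  Cintegral
    ((@lebesgue_measure R \x @lebesgue_measure R) \x @lebesgue_measure R)%E
    setT (fun y => f (vec3 y)).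

Definition dot (x y : 'cV[R]_3) : R := \sum_i x i 0 * y i 0.

End ComplexValued.

Section Smooth.
Context {R : realType} {V : normedModType R}.

(* Iterated directional derivatives along arbitrary vectors; by linearity they
   carry the same information as the partial derivatives of all orders. *)
Definition iter_derive (vs : seq V) (f : V -> R^o) : V -> R^o :=
  foldr (fun v g => 'D_v g) f vs.

Definition smooth_on (U : set V) (f : V -> R^o) : Prop :=
  forall (vs : seq V) (p : V), U p ->
    {for p, continuous (iter_derive vs f)} /\
    (forall v : V, derivable (iter_derive vs f) p v).

Definition schwartz (f : V -> R^o) : Prop :=
  smooth_on setT f /\
  forall (vs : seq V) (n : nat), exists C : R, forall x : V,
    `|x| ^+ n * `|iter_derive vs f x| <= C.

Lemma iter_deriveP (U : set V) (a : R) (f g : V -> R^o) (vs : seq V) :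
  open U -> smooth_on U f -> smooth_on U g ->
  forall p, U p -> iter_derive vs (a *: f + g) p =
                   (a *: iter_derive vs f + iter_derive vs g) p.
Proof.
move=> Uo sf sg; elim: vs => [//|v vs IH] p Up /=.
rewrite (@near_eq_derive _ _ _ _ (a *: iter_derive vs f + iter_derive vs g)).
  have [_ df] := sf vs p Up; have [_ dg] := sg vs p Up.
  by rewrite deriveD ?deriveZ//; exact: derivableZ.
by near do apply: IH; exact: open_nbhs_nbhs.
Unshelve. all: by end_near. Qed.

Lemma smooth_onP (U : set V) (a : R) (f g : V -> R^o) :
  open U -> smooth_on U f -> smooth_on U g -> smooth_on U (a *: f + g).
Proof.
move=> Uo sf sg vs p Up.
have [cf df] := sf vs p Up; have [cg dg] := sg vs p Up.
have E : \near p, (a *: iter_derive vs f + iter_derive vs g) p =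
                  iter_derive vs (a *: f + g) p.
  by near do apply/esym/(iter_deriveP a vs Uo sf sg); exact: open_nbhs_nbhs.
split=> [|v]; last first.
  by apply: near_eq_derivable E _; apply: derivableD => //; exact: derivableZ.
rewrite /prop_for /continuous_at -(nbhs_singleton E).
apply: cvg_trans; first exact: near_eq_cvg E.
by apply: cvgD => //; apply: cvgZl_tmp.
Unshelve. all: by end_near. Qed.

End Smooth.

Section Spacetime.
Context {R : realType}.

Definition spt : Type := (R^o * 'cV[R]_3)%type.
HB.instance Definition _ := NormedModule.on spt.

Definition scalar_field : Type := spt -> R^o.
HB.instance Definition _ := GRing.Lmodule.on scalar_field.

(* The manifold (0,oo) x R^3.  A function on it is encoded by its extension by
   zero to all of R x R^3, so that equality of [scalar_field]s supported in
   [spacetime] is equality of functions on the manifold. *)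
Definition spacetime : set spt := [set p | 0 < p.1].

End Spacetime.
Arguments spt : clear implicits.
Arguments scalar_field : clear implicits.
Arguments spacetime : clear implicits.

Section Geometry.
Context {R : realType}.
Implicit Types (p : spt R) (f : scalar_field R) (m n l s : 'I_4).

Definition coord_vec m : spt R :=
  if unlift ord0 m is Some i then (0, delta_mx i 0) else (1, 0).

Definition partial m f : scalar_field R := 'D_(coord_vec m) f.

Definition metric p : 'M[R]_4 :=
  \matrix_(m, n) if m != n then 0 else if m == ord0 then -1 else p.1 ^+ 2.

Definition inv_metric p : 'M[R]_4 := invmx (metric p).

Definition christoffel l m n : scalar_field R := fun p =>
  2^-1 * \sum_s inv_metric p l s *
    (partial m (fun q => metric q n s) p + partial n (fun q => metric q m s) p
     - partial s (fun q => metric q m n) p).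

Definition ricci m n : scalar_field R := fun p =>
  \sum_l (partial l (christoffel l m n) p - partial n (christoffel l m l) p) +
  \sum_l \sum_s (christoffel l l s p * christoffel s m n p
                 - christoffel l n s p * christoffel s m l p).

Definition scalar_curvature : scalar_field R := fun p =>
  \sum_m \sum_n inv_metric p m n * ricci m n p.

Definition dalembert f : scalar_field R := fun p =>
  \sum_m \sum_n inv_metric p m n *
    (partial m (partial n f) p - \sum_l christoffel l m n p * partial l f p).

Definition klein_gordon (xi : R) f : scalar_field R := fun p =>
  dalembert f p - xi * scalar_curvature p * f p.

End Geometry.

Section FunctionSpaces.
Context {R : realType}.
Implicit Types f : scalar_field R.

(* Compactly supported smooth functions on [spacetime R]. *)
Definition Cc_infty : {pred scalar_field R} := [pred f : scalar_field R | `[<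
  smooth_on (spacetime R) f /\
  exists K : set (spt R), [/\ compact K, K `<=` spacetime R &
    forall p, ~ K p -> f p = 0] >]].

(* The smoothness of f (_, x) on (0,oo) is part of the joint smoothness. *)
Definition C0S_infty : {pred scalar_field R} := [pred f : scalar_field R | `[<
  [/\ forall p, ~ spacetime R p -> f p = 0,
      smooth_on (spacetime R) f,
      forall x : 'cV[R]_3, exists K : set R,
        [/\ compact K, K `<=` [set t | 0 < t] & forall t, ~ K t -> f (t, x) = 0] &
      forall t : R, 0 < t -> schwartz (fun x : 'cV[R]_3 => f (t, x))] >]].

Lemma spacetime_open : open (spacetime R).
Proof.
have -> : spacetime R = fst @^-1` [set t : R | 0 < t] by [].
by apply: open_comp; [move=> ? _; exact: cvg_fst | exact: open_gt].
Qed.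

Lemma Cc_infty_submod : submod_closed Cc_infty.
Proof.
split=> [|a f g /asboolP[sf [K [cK Ks fK]]] /asboolP[sg [L [cL Ls gL]]]].
  apply/asboolP; split; last by exists set0; split=> //; exact: compact0.
  have it0 vs : iter_derive vs (0 : scalar_field R) = cst 0.
    elim: vs => [//|v vs /= ->].
    by apply/funext => p; exact: derive_cst.
  move=> vs p _; rewrite it0; split=> [|v]; last exact: derivable_cst.
  exact: cvg_cst.
apply/asboolP; split; first exact: smooth_onP spacetime_open sf sg.
exists (K `|` L); split; first exact: compactU.
- by move=> p [/Ks|/Ls].
- move=> p /not_orP[/fK fp0 /gL gp0].
  by rewrite -[LHS]/(a *: f p + g p) fp0 gp0 scaler0 addr0.
Qed.

HB.instance Definition _ := GRing.isSubmodClosed.Build R (scalar_field R)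
  Cc_infty Cc_infty_submod.

End FunctionSpaces.
Arguments Cc_infty : clear implicits.
Arguments C0S_infty : clear implicits.

Record test_function (R : realType) (P : submodClosed (scalar_field R)) :=
  TestFunction { test_val :> scalar_field R; _ : test_val \in P }.

Section TestFunction.
Context {R : realType} (P : submodClosed (scalar_field R)).
HB.instance Definition _ := [isSub for @test_val R P].
HB.instance Definition _ := [Choice of test_function P by <:].
HB.instance Definition _ := [SubChoice_isSubLmodule of test_function P by <:].
End TestFunction.

(* Elements (Q, a) of SO(3) \ltimes R^3. *)
Record rigid_motion (R : realType) := RigidMotion {
  rot : 'M[R]_3;
  trans : 'cV[R]_3;
  rot_orth : rot *m rot^T = 1%:M;
  rot_det : \det rot = 1 }.

Section Action.
Context {R : realType}.
Implicit Types (g : rigid_motion R) (f : scalar_field R) (p : spt R).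

(* The subgroup SO(2) \ltimes R^3 of rotations about the x^1-axis and
   translations.  Fixing e_1 is stronger than preserving the axis as a line,
   which would also allow the half-turns reversing it. *)
Definition axial_motions : set (rigid_motion R) :=
  [set g | rot g *m delta_mx 0 0 = delta_mx 0 0 :> 'cV[R]_3].

Definition inv_motion g p : spt R := (p.1, invmx (rot g) *m (p.2 - trans g)).

Definition act g f : scalar_field R := f \o inv_motion g.

Lemma rot_unit g : rot g \in unitmx.
Proof. by rewrite unitmxE rot_det unitr1. Qed.

Lemma continuous_mulmx_col (m n : nat) (A : 'M[R]_(m.+1, n.+1)) :
  continuous (fun x : 'cV[R]_n.+1 => A *m x).
Proof.
have -> : (fun x : 'cV[R]_n.+1 => A *m x) =
          (fun x => \sum_j x j 0 *: col j A).
  apply/funext => x; apply/matrixP => i k; rewrite !mxE summxE ord1.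
  by apply: eq_bigr => j _; rewrite !mxE mulrC.
apply: continuous_big => [|j _ x]; first exact: add_continuous.
apply: (@cvgZr_tmp _ _ _ _ (nbhs_filter x)).
exact: (@coord_continuous R n.+1 1 j 0 x).
Qed.

Lemma continuous_affine_snd (A : 'M[R]_3) (b c : 'cV[R]_3) :
  continuous (fun q : spt R => (q.1, A *m (q.2 - b) + c) : spt R).
Proof.
have c2 : continuous (fun q : spt R => A *m (q.2 - b) + c).
  move=> p; apply: (@cvgD _ _ _ _ (nbhs_filter p)); last exact: cvg_cst.
  apply: (@continuous_comp _ _ _ (fun q : spt R => q.2 - b)
            (fun x : 'cV[R]_3 => A *m x)).
    by apply: cvgB; [exact: cvg_snd | exact: cvg_cst].
  exact: continuous_mulmx_col.
have c1 : continuous (fun q : spt R => q.1) by move=> p; exact: cvg_fst.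
by move=> p; exact: cvg_pair (c1 p) (c2 p).
Qed.

Lemma continuous_inv_motion g : continuous (inv_motion g).
Proof.
have -> : inv_motion g =
    fun q : spt R => (q.1, invmx (rot g) *m (q.2 - trans g) + 0) : spt R.
  by apply/funext => q; rewrite addr0.
exact: continuous_affine_snd.
Qed.

Lemma inv_motion_shift g (h : R) (v p : spt R) : inv_motion g (h *: v + p) =
  h *: ((v.1, invmx (rot g) *m v.2) : spt R) + inv_motion g p.
Proof. by rewrite /inv_motion /= -addrA mulmxDr -scalemxAr. Qed.

Lemma iter_derive_act g f vs p :
  iter_derive vs (act g f) p =
  iter_derive [seq (v.1, invmx (rot g) *m v.2) | v <- vs] f (inv_motion g p).
Proof.
elim: vs p => [//|v vs IH] p /=; rewrite /derive.
apply: (congr1 (fun F : R -> R^o => lim (F h @[h --> 0^']))).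
apply/funext => h /=; rewrite !IH; congr (_ *: (iter_derive _ _ _ - _)).
exact: inv_motion_shift.
Qed.

Lemma Cc_infty_act g f : f \in Cc_infty R -> act g f \in Cc_infty R.
Proof.
move=> /asboolP[sf [K [cK Ks fK]]]; apply/asboolP; split.
  move=> vs p pos; rewrite (funext (iter_derive_act g f vs)).
  set ws := map _ _; have [cf df] := sf ws (inv_motion g p) pos.
  split=> [|v].
    apply: (@continuous_comp _ _ _ (inv_motion g)) => //.
    exact: continuous_inv_motion.
  have dv := df (v.1, invmx (rot g) *m v.2).
  apply: (eq_ind _ (fun F : R -> R^o => cvg (F h @[h --> 0^'])) dv).
  apply/funext => h /=; congr (_ *: (iter_derive _ _ _ - _)).
  by rewrite inv_motion_shift.
pose B (q : spt R) : spt R := (q.1, rot g *m q.2 + trans g).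
have BK : cancel (inv_motion g) B.
  by move=> [t x]; rewrite /B /inv_motion /= mulKVmx ?rot_unit// subrK.
have KB : cancel B (inv_motion g).
  by move=> [t x]; rewrite /B /inv_motion /= addrK mulKmx ?rot_unit.
exists (B @` K); split.
- apply: continuous_compact => //; apply: continuous_subspaceT.
  have -> : B = fun q : spt R => (q.1, rot g *m (q.2 - 0) + trans g) : spt R.
    by apply/funext => q; rewrite subr0.
  exact: continuous_affine_snd.
- by move=> _ [q /Ks Kq <-].
- move=> p pK; apply: fK => Kp; apply: pK; exists (inv_motion g p) => //.
Qed.

End Action.
Arguments axial_motions : clear implicits.

Section Kernels.
Context {R : realType}.
Implicit Types (f h : scalar_field R) (k x : 'cV[R]_3) (t tau xi lambda : R).

Definition fourier f t k : R[i] :=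
  integral_R3 (fun x => cexp ('i%C * (dot k x)%:C) * (f (t, x))%:C).

(* s is a square root of the possibly negative real number 1 - k^2 - 6 xi; the
   kernel is even in s, and the first branch is its limit as s tends to 0. *)
Definition propagator xi t tau k : R[i] :=
  let s : R[i] := sqrtC (1 - dot k k - 6 * xi)%:C in
  if s == 0 then (ln (t / tau) / (t * tau))%:C
  else (cpow t s * cpow tau (- s) - cpow t (- s) * cpow tau s) /
       ((2 * t * tau)%:C * s).

Definition axial_weight lambda k : R := cosh (3 * lambda * k 0 0).

Definition propagator_star lambda xi t tau k : R[i] :=
  propagator xi t tau k / (axial_weight lambda k)%:C.

Definition propagate xi f t k : R[i] :=
  - integral_pos (fun tau =>
      (tau ^+ 3)%:C * propagator xi t tau k * fourier f tau k).

(* For real fields and the kernels used below the integral is real, since the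
   Fourier transform of f at -k is the conjugate of that at k. *)
Definition causal_form (D : R -> R -> 'cV[R]_3 -> R[i]) f h : R :=
  complex.Re (- integral_pos (fun t => (t ^+ 3)%:C *
    integral_pos (fun tau => (tau ^+ 3)%:C *
      integral_R3 (fun k => (((2 * pi) ^+ 3)^-1)%:C *
        (fourier f t (- k) * D t tau k * fourier h tau k))))).

Definition omega xi := causal_form (propagator xi).
Definition omega_star lambda xi := causal_form (propagator_star lambda xi).

(* Fourier multiplier: the inverse transform of
   (axial_weight lambda k)^(-1/2) * fourier f t k.  The integral is real because
   the multiplier is real and even. *)
Definition smear lambda f : scalar_field R := fun p =>
  complex.Re (integral_R3 (fun k => (((2 * pi) ^+ 3)^-1)%:C *
    (cexp (- 'i%C * (dot k p.2)%:C) *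
      ((Num.sqrt (axial_weight lambda k))^-1)%:C * fourier f p.1 k))).

End Kernels.

Section SymplecticSpaces.
Context {R : realType} (xi : R).

Definition range_klein_gordon : {pred test_function (Cc_infty R)} :=
  [pred h : test_function (Cc_infty R) | `[<
    exists f : test_function (Cc_infty R),
      forall p, spacetime R p -> (h : scalar_field R) p = klein_gordon xi f p >]].

Definition ker_propagate (P : submodClosed (scalar_field R)) :
    {pred test_function P} :=
  [pred f : test_function P | `[<
    forall (t : R) (k : 'cV[R]_3), 0 < t -> propagate xi f t k = 0 >]].

Lemma klein_gordonP (a : R) (f g : scalar_field R) p :
  smooth_on (spacetime R) f -> smooth_on (spacetime R) g -> spacetime R p ->
  klein_gordon xi (a *: f + g) p = a * klein_gordon xi f p + klein_gordon xi g p.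
Proof.
move=> sf sg Mp.
have P1 m : partial m (a *: f + g) p = a * partial m f p + partial m g p.
  exact: (iter_deriveP a [:: coord_vec m] spacetime_open sf sg Mp).
have P2 m n : partial m (partial n (a *: f + g)) p =
    a * partial m (partial n f) p + partial m (partial n g) p.
  exact: (iter_deriveP a [:: coord_vec m; coord_vec n] spacetime_open sf sg Mp).
have -> : klein_gordon xi (a *: f + g) p =
  dalembert (a *: f + g) p - xi * scalar_curvature p * (a * f p + g p) by [].
rewrite /klein_gordon.
suff -> : dalembert (a *: f + g) p = a * dalembert f p + dalembert g p.
  by rewrite !mulrDr opprD addrACA mulrN mulrCA.
rewrite /dalembert mulr_sumr -big_split; apply: eq_bigr => m _ /=.
rewrite mulr_sumr -big_split; apply: eq_bigr => n _ /=.
rewrite mulrCA -mulrDr P2; congr (_ * _).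
rewrite mulrBr addrACA -opprD; congr (_ - _).
rewrite mulr_sumr -big_split; apply: eq_bigr => l _ /=.
by rewrite P1 mulrDr mulrCA.
Qed.

Lemma range_klein_gordon_submod : submod_closed range_klein_gordon.
Proof.
split=> [|a u v /asboolP[f uf] /asboolP[g vg]]; apply/asboolP.
  exists 0 => p Mp.
  have /asboolP[s0 _] : (0 : scalar_field R) \in Cc_infty R by exact: rpred0.
  have := klein_gordonP (- 1) s0 s0 Mp.
  by rewrite scaler0 addr0 mulN1r addNr => ->.
exists (a *: f + g) => p Mp.
have /asboolP[sf _] := valP f; have /asboolP[sg _] := valP g.
by rewrite [RHS](klein_gordonP a sf sg Mp) -uf// -vg.
Qed.

HB.instance Definition _ := GRing.isSubmodClosed.Build R
  (test_function (Cc_infty R)) range_klein_gordon range_klein_gordon_submod.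

End SymplecticSpaces.
Arguments ker_propagate {R} xi P.

(* The defining conditions of C0S_infty are pointwise in x, respectively t:
   they do not bound the t-support uniformly in x, so that for some members of
   C0S_infty the tau-integral of [propagate] diverges and [smear] leaves the
   space.  The test functions are therefore those of any linear space between
   Cc_infty and C0S_infty on which these constructions make sense: the kernel of
   [propagate] is a linear subspace, and the Euclidean motions and [smear] map
   the space to itself.  C0S_infty is the largest candidate; the smooth compactly
   supported functions of t with values in the Schwartz space form an example. *)
Record ext_space (R : realType) (lambda xi : R) := ExtSpace {
  ext_pred :> submodClosed (scalar_field R);
  Cc_infty_ext : {subset Cc_infty R <= ext_pred};
  ext_C0S_infty : {subset ext_pred <= C0S_infty R};
  ext_ker_submod : submod_closed (ker_propagate xi ext_pred);
  ext_act : forall (g : rigid_motion R) (f : scalar_field R),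
    f \in ext_pred -> act g f \in ext_pred;
  ext_smear : forall f : scalar_field R,
    f \in ext_pred -> smear lambda f \in ext_pred }.

Section Spaces.
Context {R : realType} (lambda xi : R).

Definition V_star : lmodType R := quot (range_klein_gordon xi).

Definition class_star (f : test_function (Cc_infty R)) : V_star := qclass _ f.

Definition form_star : V_star -> V_star -> R :=
  quot_form (fun f h : test_function (Cc_infty R) => omega_star lambda xi f h).

Definition act_Cc (g : rigid_motion R) (f : test_function (Cc_infty R)) :
    test_function (Cc_infty R) :=
  TestFunction (Cc_infty_act g (valP f)).

Variable E : ext_space lambda xi.

HB.instance Definition _ := GRing.isSubmodClosed.Build R (test_function E)
  (ker_propagate xi E) (ext_ker_submod E).

Definition V_ext : lmodType R := quot (ker_propagate xi E).

Definition class_ext (f : test_function E) : V_ext := qclass _ f.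

Definition form_ext : V_ext -> V_ext -> R :=
  quot_form (fun f h : test_function E => omega xi f h).

Definition form_ext_star : V_ext -> V_ext -> R :=
  quot_form (fun f h : test_function E => omega_star lambda xi f h).

Definition act_ext (g : rigid_motion R) (f : test_function E) :
    test_function E :=
  TestFunction (ext_act g (valP f)).

Definition smear_ext (f : test_function E) : test_function E :=
  TestFunction (ext_smear (valP f)).

Definition incl_ext (f : test_function (Cc_infty R)) : test_function E :=
  TestFunction (@Cc_infty_ext _ _ _ E _ (valP f)).

End Spaces.
Arguments V_star {R} xi.
Arguments class_star {R} xi f.
Arguments form_star {R} lambda xi.
Arguments V_ext {R lambda xi} E.
Arguments class_ext {R lambda xi} E f.
Arguments form_ext {R lambda xi} E.
Arguments form_ext_star {R lambda xi} E.
Arguments act_ext {R lambda xi} E g f.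
Arguments smear_ext {R lambda xi} E f.
Arguments incl_ext {R lambda xi} E f.

Section Weyl.
Context {R : realType}.
Implicit Types A B : cstarAlgType R.

Definition star_subalgebra A (S : set A) : Prop :=
  [/\ S 1, forall (c : R[i]) a b, S a -> S b -> S (c *: a + b),
      forall a b, S a -> S b -> S (a * b) & forall a, S a -> S (star a)].

Definition cnorm_closed A (S : set A) : Prop :=
  forall (u : nat -> A) (l : A), (forall n, S (u n)) ->
    (fun n => cnorm (u n - l)) @ \oo --> (0 : R) -> S l.

Definition generated_by A (G : set A) : Prop :=
  forall S : set A,
    star_subalgebra S -> cnorm_closed S -> G `<=` S -> S = setT.

Definition is_weyl_algebra (V : lmodType R) (rho : V -> V -> R) A (W : V -> A) :
    Prop :=
  [/\ W 0 = 1,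
      forall v, star (W v) = W (- v),
      forall v w, W v * W w = cexp (- 'i%C * (rho v w / 2)%:C) *: W (v + w) &
      generated_by (range W)].

Definition is_star_morphism A B (f : A -> B) : Prop :=
  [/\ linear f, monoid_morphism f & forall a, f (star a) = star (f a)].

Definition is_star_automorphism A (f : A -> A) : Prop :=
  is_star_morphism f /\ bijective f.

Definition is_state A (Omega : A -> R[i]) : Prop :=
  [/\ linear (Omega : A -> R[i]^o), Omega 1 = 1 &
      forall a, 0 <= Omega (star a * a)].

(* beta g is the automorphism W(v) |-> W(g v) for g in G, where the classes v
   are given by representatives f : T. *)
Definition weyl_action (G : set (rigid_motion R)) (V : lmodType R) A (W : V -> A)
    (T : Type) (cls : T -> V) (act : rigid_motion R -> T -> T)
    (beta : rigid_motion R -> A -> A) : Prop :=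
  forall g, G g -> is_star_automorphism (beta g) /\
    forall f : T, beta g (W (cls f)) = W (cls (act g f)).

Definition invariant_under (G : set (rigid_motion R)) A
    (beta : rigid_motion R -> A -> A) (Omega : A -> R[i]) : Prop :=
  forall g, G g -> forall a, Omega (beta g a) = Omega a.

End Weyl.

(* Main.v *)
From HB Require Import structures.
Require Import Defs.
From mathcomp Require Import all_boot all_order all_algebra.
From mathcomp Require Import complex.
From mathcomp Require Import all_classical all_reals all_analysis.
From mathcomp Require Import ring lra.

Set Implicit Arguments.
Unset Strict Implicit.
Unset Printing Implicit Defensive.

Import Order.TTheory GRing.Theory Num.Theory.
Import numFieldNormedType.Exports.
Import measurable_realfun.
Local Open Scope classical_set_scope.
Local Open Scope complex_scope.
Local Open Scope ring_scope.

(** A state is positive, and [1 - h] is a square when [h] is selfadjoint of small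
    norm, so states are norm-bounded.  Weyl operators span a dense subspace, hence
    a state is determined by its values on them.  Both [Omega_ext \o SS] and its
    composition with the automorphism induced by an axial motion g are states, and
    they agree on Weyl operators because [smear] commutes with g and [Omega_ext]
    is invariant.  For the commutation, g moves through the Fourier transform by
    a change of variables, which turns the translation into a phase; the phase
    leaves the integral because Schwartz functions are integrable, and the weight
    cosh(3 lambda k_1)^(-1/2) is unchanged since g fixes the first axis. *)

(** * Measure-preserving changes of variables *)

Section MeasureAutomorphism.
Context d (T : measurableType d) (R : realType).
Variable mu : {measure set T -> \bar R}.
Local Open Scope ereal_scope.

Definition measure_preserving (phi : T -> T) :=
  measurable_fun setT phi /\
  forall A, measurable A -> mu (phi @^-1` A) = mu A.

(** The inverse is only required to be measurable; that it preserves the measure follows. *)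
Definition measure_automorphism (phi : T -> T) :=
  measure_preserving phi /\
  exists psi, [/\ measurable_fun setT psi, cancel phi psi & cancel psi phi].

Lemma measure_automorphism_comp (phi chi : T -> T) :
  measure_automorphism phi -> measure_automorphism chi ->
  measure_automorphism (phi \o chi).
Proof.
move=> [[mphi iphi] [phi' [mphi' phiK phi'K]]].
move=> [[mchi ichi] [chi' [mchi' chiK chi'K]]].
split.
  split=> [|A mA]; first exact: measurableT_comp.
  rewrite (comp_preimage A chi phi) ichi ?iphi//.
  by rewrite -[X in measurable X]setTI; exact: mphi.
exists (chi' \o phi'); split; first exact: measurableT_comp.
- by move=> x /=; rewrite phiK chiK.
- by move=> x /=; rewrite chi'K phi'K.
Qed.

Import HBNNSimple.

(** If [h] is a simple function below [f], then [h \o phi] is a simple function below [f \o phi]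
    with the same integral, because [phi] preserves the measure of each level set of [h]. *)
Let ge0_integral_comp_ge (phi : T -> T) (f : T -> \bar R) :
  measure_preserving phi -> (forall x, 0 <= f x) ->
  \int[mu]_x f x <= \int[mu]_x f (phi x).
Proof.
move=> [mphi iphi] f0.
rewrite (ge0_integralTE _ f0) ge0_integralTE//.
apply: ge_ereal_sup => _ /= [h hf <-].
apply: ereal_sup_ubound => /=.
have fin : finite_set (range (h \o phi)).
  apply: (@sub_finite_set _ _ (range h)).
    by move=> _ [x _ <-]; exists (phi x).
  exact: fimfunP.
have mh : measurable_fun setT (h \o phi) by exact: measurableT_comp.
pose fI := FiniteImage.Build _ _ (h \o phi) fin.
pose mI := isMeasurableFun.Build _ _ _ _ (h \o phi) mh.
have h0 : forall x, (0 <= (h \o phi) x)%R by move=> x; exact: fun_ge0.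
pose nI := isNonNegFun.Build _ _ (h \o phi) h0.
pose g : {nnsfun T >-> R} := HB.pack (h \o phi) fI mI nI.
exists g; first by move=> x; exact: hf.
rewrite /sintegral; apply: eq_fsbigr => r _; congr (_ * _).
exact: iphi.
Qed.

(** The reverse inequality is the previous lemma for the inverse [psi] and the function [f \o phi];
    [psi] preserves the measure because [psi \o phi] is the identity. *)
Let ge0_integral_automorphism (phi : T -> T) (f : T -> \bar R) :
  measure_automorphism phi -> (forall x, 0 <= f x) ->
  \int[mu]_x f (phi x) = \int[mu]_x f x.
Proof.
move=> [[mphi iphi] [psi [mpsi phiK psiK]]] f0.
apply/eqP; rewrite eq_le; apply/andP; split; last first.
  exact: ge0_integral_comp_ge.
have psi_pres : measure_preserving psi.
  split=> // A mA.
  rewrite -[LHS]iphi; last by rewrite -[X in measurable X]setTI; exact: mpsi.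
  by rewrite -comp_preimage (_ : psi \o phi = id) //; apply/funext.
have := ge0_integral_comp_ge psi_pres (fun x => f0 (phi x)).
by under [X in _ <= X -> _]eq_integral do rewrite psiK.
Qed.

(* [phi] permutes the simple functions, so the suprema defining the two integrals
   agree for every [f], measurable or not. *)
Lemma integral_automorphism (phi : T -> T) (f : T -> \bar R) :
  measure_automorphism phi -> \int[mu]_x f (phi x) = \int[mu]_x f x.
Proof.
move=> aphi; rewrite integralE [RHS]integralE.
congr (adde _ (oppe _)).
- under eq_integral do rewrite (funepos_comp f phi) /=.
  exact: ge0_integral_automorphism.
- under eq_integral do rewrite (funeneg_comp f phi) /=.
  exact: ge0_integral_automorphism.
Qed.

End MeasureAutomorphism.

(** * Shears of product measures *)

Section Shears.
Local Open Scope ereal_scope.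
Context d1 d2 (T1 : measurableType d1) (T2 : measurableType d2) (R : realType).
Variable m1 : {sigma_finite_measure set T1 -> \bar R}.
Variable m2 : {sigma_finite_measure set T2 -> \bar R}.

(** The product measure integrates the [m2]-measures of the sections at fixed first coordinate, and
    [s x] preserves each of them. *)
Lemma measure_automorphism_shear2 (s s' : T1 -> T2 -> T2) :
  measurable_fun setT (fun z : T1 * T2 => s z.1 z.2) ->
  measurable_fun setT (fun z : T1 * T2 => s' z.1 z.2) ->
  (forall x, cancel (s x) (s' x)) -> (forall x, cancel (s' x) (s x)) ->
  (forall x, measure_preserving m2 (s x)) ->
  measure_automorphism (m1 \x m2) (fun z : T1 * T2 => (z.1, s z.1 z.2)).
Proof.
move=> ms ms' sK s'K ps; split.
  split=> [|A mA].
    by apply: measurable_fun_pair => //; exact: measurable_fst.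
  apply: eq_integral => x _ /=.
  have [_ /(_ _ (measurable_xsection x mA)) <-] := ps x.
  by congr (m2 _).
exists (fun z : T1 * T2 => (z.1, s' z.1 z.2)); split.
- by apply: measurable_fun_pair => //; exact: measurable_fst.
- by move=> [x y] /=; rewrite sK.
- by move=> [x y] /=; rewrite s'K.
Qed.

(** Here sections at fixed second coordinate are needed, so the product measure is first replaced by
    the one iterated in the other order; the two agree on rectangles, hence everywhere. *)
Lemma measure_automorphism_shear1 (s s' : T2 -> T1 -> T1) :
  measurable_fun setT (fun z : T1 * T2 => s z.2 z.1) ->
  measurable_fun setT (fun z : T1 * T2 => s' z.2 z.1) ->
  (forall y, cancel (s y) (s' y)) -> (forall y, cancel (s' y) (s y)) ->
  (forall y, measure_preserving m1 (s y)) ->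
  measure_automorphism (m1 \x m2) (fun z : T1 * T2 => (s z.2 z.1, z.2)).
Proof.
move=> ms ms' sK s'K ps.
have mz : measurable_fun setT (fun z : T1 * T2 => (s z.2 z.1, z.2)).
  by apply: measurable_fun_pair => //; exact: measurable_snd.
have E (A : set (T1 * T2)) : measurable A -> (m1 \x m2) A = (m1 \x^ m2) A.
  apply: product_measure_unique => B C mB mC.
  exact: product_measure2E.
split.
  split=> [//|A mA].
  apply: etrans (etrans _ (esym (E _ mA))).
    by apply: E; rewrite -[X in measurable X]setTI; exact: mz.
  apply: eq_integral => y _ /=.
  have [_ /(_ _ (measurable_ysection y mA)) <-] := ps y.
  by congr (m1 _).
exists (fun z : T1 * T2 => (s' z.2 z.1, z.2)); split.
- by apply: measurable_fun_pair => //; exact: measurable_snd.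
- by move=> [x y] /=; rewrite sK.
- by move=> [x y] /=; rewrite s'K.
Qed.

Lemma measure_automorphism_fst (phi : T1 -> T1) : measure_automorphism m1 phi ->
  measure_automorphism (m1 \x m2) (fun z => (phi z.1, z.2)).
Proof.
move=> [[mphi iphi] [psi [mpsi phiK psiK]]].
apply: (@measure_automorphism_shear1 (fun=> phi) (fun=> psi)) => //.
- by apply: measurableT_comp => //; exact: measurable_fst.
- by apply: measurableT_comp => //; exact: measurable_fst.
Qed.

Lemma measure_automorphism_snd (phi : T2 -> T2) : measure_automorphism m2 phi ->
  measure_automorphism (m1 \x m2) (fun z => (z.1, phi z.2)).
Proof.
move=> [[mphi iphi] [psi [mpsi phiK psiK]]].
apply: (@measure_automorphism_shear2 (fun=> phi) (fun=> psi)) => //.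
- by apply: measurableT_comp => //; exact: measurable_snd.
- by apply: measurableT_comp => //; exact: measurable_snd.
Qed.

End Shears.

(** * Translations and axial rotations of Euclidean 3-space *)

Section LebesgueR3.
Context {R : realType}.
Local Notation mu := (@lebesgue_measure R).

(** The image of Lebesgue measure under a translation gives each half-open interval its length,
    which characterizes Lebesgue measure. *)
Lemma lebesgue_measure_translation (a : R) :
  measure_preserving mu (fun x : measurableTypeR R => x + a).
Proof.
have mh : measurable_fun setT
    (fun x : measurableTypeR R => x + a : measurableTypeR R).
  exact: measurable_funD.
split=> [//|A mA]; apply/esym.
pose mI := isMeasurableFun.Build _ _ _ _ _ mh.
pose h : {mfun measurableTypeR R >-> measurableTypeR R} :=
  HB.pack (fun x : measurableTypeR R => x + a : measurableTypeR R) mI.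
apply: (@lebesgue_measure_unique R (pushforward mu h)) => // _ [[u v]] _ <-.
rewrite /pushforward /=.
rewrite [X in _ = mu X](_ : _ = `]u - a, v - a]%classic); last first.
  apply/seteqP; split=> x /=; rewrite /h /= !in_itv /=;
  by rewrite ltrBlDr lerBrDr.
by rewrite !lebesgue_measure_itv/= !lte_fin ltrD2r -!EFinB opprB addrA subrK.
Qed.

Local Notation mu2 := (mu \x mu)%E.
Local Notation mu3 := ((mu \x mu) \x mu)%E.
Local Notation R1 := (measurableTypeR R).
Local Notation cV3 := 'cV[R]_3.

Lemma translation_automorphism (a : R) :
  measure_automorphism mu (fun x : R1 => x + a : R1).
Proof.
split; first exact: lebesgue_measure_translation.
exists (fun x => x - a); split; last 2 first.
- by move=> x; rewrite addrK.
- by move=> x; rewrite subrK.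
- by have [] := lebesgue_measure_translation (- a).
Qed.

Lemma sigma_finite_lebesgue2 : sigma_finite setT mu2.
Proof.
have /sigma_finiteP[F [TF ndF mF]] := sigma_finiteT mu.
(* The squares of an increasing exhaustion of the line cover the plane: monotonicity puts both
   coordinates in a common member. *)
exists (fun n => F n `*` F n) => [|n]; last first.
  have [mFn Fn_fin] := mF n; split; first exact: measurableX.
  by rewrite /= product_measure1E// lte_mul_pinfty// ge0_fin_numE.
apply/esym; rewrite -subTset => -[x y] _.
have [[m _ Fmx] [n _ Fny]] : (\bigcup_k F k) x /\ (\bigcup_k F k) y.
  by rewrite -TF.
exists (maxn m n) => //; split=> /=.
  exact: (subsetPset _ _ (ndF _ _ (leq_maxl m n))) Fmx.
exact: (subsetPset _ _ (ndF _ _ (leq_maxr m n))) Fny.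
Qed.

(* The library's own instance for products is shadowed by the one for products
   of subprobabilities. *)
Definition lebesgue2 : {sigma_finite_measure set (R1 * R1)%type -> \bar R} :=
  HB.pack mu2 (Measure_isSigmaFinite.Build _ _ _ mu2 sigma_finite_lebesgue2).

(** All integrands are allowed, so the property applies to Fourier transforms without a proof that
    they are measurable. *)
Definition integral_invariant (F : cV3 -> cV3) :=
  forall f : cV3 -> R[i], integral_R3 (f \o F) = integral_R3 f.

Lemma integral_invariant_comp F G : integral_invariant F ->
  integral_invariant G -> integral_invariant (F \o G).
Proof. by move=> iF iG f; rewrite -(iF f) -[RHS]iG. Qed.

Lemma integral_invariant_automorphism (F : cV3 -> cV3)
    (phi : R1 * R1 * R1 -> R1 * R1 * R1) :
  measure_automorphism mu3 phi -> (forall y, F (vec3 y) = vec3 (phi y)) ->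
  integral_invariant F.
Proof.
move=> aphi Fphi f; rewrite /integral_R3 /Cintegral /Rintegral.
congr (Complex (fine _) (fine _)).
- rewrite -[RHS](integral_automorphism _ aphi).
  by apply: eq_integral => y _ /=; rewrite Fphi.
- rewrite -[RHS](integral_automorphism _ aphi).
  by apply: eq_integral => y _ /=; rewrite Fphi.
Qed.

Lemma cV3P (x y : cV3) :
  x 0 0 = y 0 0 -> x 1 0 = y 1 0 -> x 2 0 = y 2 0 -> x = y.
Proof.
move=> e0 e1 e2; apply/colP => i.
by case: i => [[|[|[|//]]] Hi];
  [move: e0 | move: e1 | move: e2];
  (congr (_ = _); [congr (x _ _) | congr (y _ _)]); apply: val_inj.
Qed.

Lemma integral_invariant_translation (a : cV3) :
  integral_invariant (fun x => x + a).
Proof.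
have A0 : measure_automorphism mu3
    (fun z : R1 * R1 * R1 => (z.1.1 + a 0 0, z.1.2, z.2)).
  apply: (@measure_automorphism_fst _ _ _ _ _ lebesgue2 mu
    (fun u => (u.1 + a 0 0, u.2))).
  exact: (@measure_automorphism_fst _ _ _ _ _ mu mu
    (fun x => x + a 0 0) (translation_automorphism _)).
have A1 : measure_automorphism mu3
    (fun z : R1 * R1 * R1 => (z.1.1, z.1.2 + a 1 0, z.2)).
  apply: (@measure_automorphism_fst _ _ _ _ _ lebesgue2 mu
    (fun u => (u.1, u.2 + a 1 0))).
  exact: (@measure_automorphism_snd _ _ _ _ _ mu mu
    (fun x => x + a 1 0) (translation_automorphism _)).
have A2 : measure_automorphism mu3
    (fun z : R1 * R1 * R1 => (z.1, z.2 + a 2 0)).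
  exact: (@measure_automorphism_snd _ _ _ _ _ lebesgue2 mu
    (fun x => x + a 2 0) (translation_automorphism _)).
apply: (integral_invariant_automorphism
  (measure_automorphism_comp A0 (measure_automorphism_comp A1 A2))).
by move=> y; apply: cV3P; rewrite !mxE.
Qed.

Definition shear (i j : 'I_3) (al : R) (x : cV3) : cV3 :=
  x + (al * x j 0) *: delta_mx i 0.

(** At fixed last coordinate this shear is a translation of the middle one. *)
Lemma integral_invariant_shear12 (al : R) :
  integral_invariant (shear 1 2 al).
Proof.
have M (be : R) : measurable_fun setT
    (fun z : R1 * R1 * R1 => (z.1.1, z.1.2 + be * z.2) : R1 * R1).
  apply: measurable_fun_pair.
    by apply: measurableT_comp; exact: measurable_fst.
  apply: measurable_funD.
    by apply: measurableT_comp; [exact: measurable_snd|exact: measurable_fst].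
  by apply: measurable_funM => //; exact: measurable_snd.
apply: (@integral_invariant_automorphism _
  (fun z : R1 * R1 * R1 => ((z.1.1, z.1.2 + al * z.2), z.2))); last first.
  by move=> y; apply: cV3P; rewrite !mxE /= ?mulr1 ?mulr0 ?addr0.
apply: (@measure_automorphism_shear1 _ _ _ _ _ lebesgue2 mu
  (fun y u => (u.1, u.2 + al * y)) (fun y u => (u.1, u.2 + (- al) * y))) => //.
- by move=> y [u v] /=; rewrite mulNr addrK.
- by move=> y [u v] /=; rewrite mulNr subrK.
- move=> y.
  by have [] := measure_automorphism_snd mu (translation_automorphism (al * y)).
Qed.

Lemma integral_invariant_shear21 (al : R) :
  integral_invariant (shear 2 1 al).
Proof.
have M (be : R) : measurable_fun setT
    (fun z : R1 * R1 * R1 => z.2 + be * z.1.2 : R1).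
  apply: measurable_funD; first exact: measurable_snd.
  apply: measurable_funM => //.
  by apply: measurableT_comp; [exact: measurable_snd|exact: measurable_fst].
apply: (@integral_invariant_automorphism _
  (fun z : R1 * R1 * R1 => (z.1, z.2 + al * z.1.2))); last first.
  by move=> y; apply: cV3P; rewrite !mxE /= ?mulr1 ?mulr0 ?addr0.
apply: (@measure_automorphism_shear2 _ _ _ _ _ lebesgue2 mu
  (fun u y => y + al * u.2) (fun u y => y + (- al) * u.2)) => //.
- by move=> u y /=; rewrite mulNr addrK.
- by move=> u y /=; rewrite mulNr subrK.
- by move=> u; exact: lebesgue_measure_translation.
Qed.

Definition rot23 (c s : R) (x : cV3) : cV3 :=
  vec3 (x 0 0, c * x 1 0 - s * x 2 0, s * x 1 0 + c * x 2 0).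

(* A rotation of the plane by an angle outside pi Z is a product of three
   shears, and the half-turn is the square of a quarter-turn. *)
Lemma integral_invariant_rot23 (c s : R) :
  c ^+ 2 + s ^+ 2 = 1 -> integral_invariant (rot23 c s).
Proof.
have rot_shear (c' s' : R) : s' != 0 -> c' ^+ 2 + s' ^+ 2 = 1 ->
    integral_invariant (rot23 c' s').
  (* For a rotation by theta, [be] is - tan (theta / 2), the coefficient of both outer shears. *)
  move=> s'0 cs'; pose be := (c' - 1) / s'.
  have -> : rot23 c' s' = shear 1 2 be \o (shear 2 1 s' \o shear 1 2 be).
    have sbe : s' * be = c' - 1 by rewrite /be mulrCA divff ?mulr1.
    have bec : be * (1 + c') = - s'.
      apply: (mulfI s'0); rewrite mulrA sbe.
      have -> : (c' - 1) * (1 + c') = c' ^+ 2 - 1 by ring.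
      by rewrite -cs'; ring.
    apply/funext => x; apply: cV3P; rewrite !mxE /=.
    - by ring.
    - transitivity ((1 + s' * be) * x 1 0 + be * (2 + s' * be) * x 2 0).
        rewrite sbe (_ : 2 + (c' - 1) = 1 + c'); last by ring.
        by rewrite bec; ring.
      by ring.
    - transitivity (s' * x 1 0 + (1 + s' * be) * x 2 0).
        by rewrite sbe; ring.
      by ring.
  apply: integral_invariant_comp; first exact: integral_invariant_shear12.
  apply: integral_invariant_comp; first exact: integral_invariant_shear21.
  exact: integral_invariant_shear12.
move=> cs; have [s0|s0] := eqVneq s 0; last exact: rot_shear.
have c0 : - c != 0.
  by apply/eqP => c0; move: cs; rewrite s0 -sqrrN c0 !expr0n addr0 => /eqP;
     rewrite eq_sym oner_eq0.
(* Here c is 1 or -1; for c = 1 the two quarter-turns are opposite and compose to the identity. *)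
have -> : rot23 c s = rot23 0 1 \o rot23 0 (- c).
  by apply/funext => x; apply: cV3P; rewrite !mxE /= ?mxE /= ?s0; ring.
apply: integral_invariant_comp; apply: rot_shear; rewrite ?oner_eq0//.
  by rewrite expr0n expr1n add0r.
by rewrite sqrrN -cs s0 addrC.
Qed.

Lemma sum3 (V : nmodType) (F : 'I_3 -> V) : \sum_i F i = F 0 + F 1 + F 2.
Proof.
rewrite !big_ord_recl big_ord0 addr0 addrA.
by congr (_ + F _ + F _); apply: val_inj.
Qed.

(** The first column is the first basis vector, so the unit norm of the first row kills its other
    entries. The remaining block is orthogonal of determinant 1: its transpose equals its adjugate,
    which forces the form of a plane rotation. *)
Lemma axial_rot (g : rigid_motion R) : axial_motions R g ->
  exists c s : R, c ^+ 2 + s ^+ 2 = 1 /\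
    forall x : cV3, Defs.rot g *m x = rot23 c s x.
Proof.
case: g => Q a Qo Qd; rewrite /axial_motions /= => Qe.
have Q0 i : Q i 0 = (i == 0)%:R.
  have := congr1 (fun v : cV3 => v i 0) Qe.
  by rewrite -colE !mxE eqxx andbT.
have Qr i j : \sum_k Q i k * Q j k = (i == j)%:R.
  have := congr1 (fun M : 'M[R]_3 => M i j) Qo; rewrite !mxE => <-.
  by apply: eq_bigr => k _; rewrite mxE.
have := Qr 0 0; have := Qr 1 1; have := Qr 2 2; have := Qr 1 2.
rewrite !sum3 !Q0 /= !(mulr0, mul0r, add0r, mulr1).
move=> r12 r22 r11 r00.
have [Q01 Q02] : Q 0 1 = 0 /\ Q 0 2 = 0.
  by split; nra.
have {}Qd : Q 1 1 * Q 2 2 - Q 1 2 * Q 2 1 = 1.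
  rewrite -Qd (expand_det_col Q 0) sum3 !Q0 /= !mul0r !addr0 mul1r.
  rewrite /cofactor /= expr0 mul1r (expand_det_row _ 0) big_ord_recl big_ord1.
  rewrite /cofactor !det_mx11 !mxE /= expr0 expr1 !mul1r.
  rewrite mulN1r mulrN.
  by congr (Q _ _ * Q _ _ - Q _ _ * Q _ _); apply: val_inj.
have E22 : Q 2 2 = Q 1 1.
  transitivity (Q 2 2 * (Q 1 1 * Q 1 1 + Q 1 2 * Q 1 2)).
    by rewrite r11 mulr1.
  transitivity (Q 1 1 * (Q 1 1 * Q 2 2 - Q 1 2 * Q 2 1)
    + Q 1 2 * (Q 1 1 * Q 2 1 + Q 1 2 * Q 2 2)); first by ring.
  by rewrite Qd r12 mulr0 addr0 mulr1.
have E12 : Q 1 2 = - Q 2 1.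
  transitivity (- Q 2 1 * (Q 1 1 * Q 1 1 + Q 1 2 * Q 1 2)
    + (Q 1 1 * (Q 1 1 * Q 2 1 + Q 1 2 * Q 2 2)
    - Q 1 2 * ((Q 1 1 * Q 2 2 - Q 1 2 * Q 2 1) - 1))); first by ring.
  by rewrite r11 r12 Qd subrr !mulr0 subr0 addr0 mulr1.
exists (Q 1 1), (Q 2 1); split; first by rewrite -E22 addrC !expr2; exact: r22.
move=> x; apply: cV3P; rewrite !mxE sum3 ?Q01 ?Q02 !Q0 /= ?E12 ?E22; ring.
Qed.

Lemma integral_invariant_axial (g : rigid_motion R) : axial_motions R g ->
  integral_invariant (mulmx (Defs.rot g)).
Proof.
move=> /axial_rot[c [s [cs Es]]].
by rewrite (funext Es : mulmx _ = _); exact: integral_invariant_rot23.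
Qed.

End LebesgueR3.

(** * Integrability of Schwartz functions *)

Section Caratheodory.
Context d (T : measurableType d) (R : realType).
Local Notation R1 := (measurableTypeR R).

Let grid (n : nat) (y : R) : R := (Num.floor (y * n.+1%:R))%:~R / n.+1%:R.

Let grid_cvg (y : R) : (fun n => grid n y) @ \oo --> y.
Proof.
apply/cvgrPdist_le => e e0.
have [N HN] : exists N : nat, forall n, (N <= n)%N -> n.+1%:R^-1 <= e.
  exists (Num.truncn e^-1) => n Nn.
  rewrite invf_ple ?posrE// ltW// (lt_le_trans (truncnS_gt _))// ler_nat.
  by rewrite ltnS.
exists N => // n /= Nn; apply: le_trans (HN n Nn).
have /andP[f1 f2] := floor_itv (y * n.+1%:R).
have n0 : 0 < n.+1%:R :> R by [].
have -> : y - grid n y =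
    (y * n.+1%:R - (Num.floor (y * n.+1%:R))%:~R) / n.+1%:R.
  by rewrite mulrBl mulfK// gt_eqF.
rewrite normrM normfV (ger0_norm (ltW n0)) ler_piMl ?invr_ge0 ?(ltW n0)//.
rewrite ger0_norm ?subr_ge0// lerBlDl (le_trans (ltW f2))// intrD //.
Qed.

(** Rounding the second variable down to multiples of 1/(n+1) gives functions converging pointwise
    to [F] by continuity. Each is measurable, being glued from countably many strips on which it
    depends on the first variable only. *)
Lemma caratheodory_measurable (F : T -> R -> R) :
  (forall y, measurable_fun setT (F^~ y)) -> (forall u, continuous (F u)) ->
  measurable_fun setT (fun z : T * R1 => F z.1 z.2).
Proof.
move=> mF cF.
apply: (@measurable_fun_cvg _ _ _ _
  (fun n z => F z.1 (grid n z.2))); last first.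
  move=> z _ /=.
  apply: (@continuous_cvg nat R R \oo _ (fun n => grid n z.2) (F z.1) z.2).
    exact: cF.
  exact: grid_cvg.
move=> n _ A mA; rewrite setTI.
pose cell (i : int) := [set y : R1 | Num.floor (y * n.+1%:R) = i].
have -> : (fun z : T * R1 => F z.1 (grid n z.2)) @^-1` A =
    \bigcup_(i : int) ((F^~ (i%:~R / n.+1%:R) @^-1` A) `*` cell i).
  apply/seteqP; split=> [z Az|z [i _ [/= Az zi]]] /=.
    by exists (Num.floor (z.2 * n.+1%:R)).
  by rewrite /grid zi.
apply: countable_bigcupT_measurable => // i; apply: measurableX.
  by rewrite -[X in measurable X]setTI; exact: mF.
have -> : cell i = (fun y : R1 => y * n.+1%:R : R1) @^-1` `[i%:~R, (i + 1)%:~R[.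
  apply/seteqP; split=> y /=; rewrite in_itv /=.
    by move=> <-; exact: floor_itv.
  by move=> /floor_def.
rewrite -[X in measurable X]setTI.
exact: (mulrr_measurable _ measurableT).
Qed.

End Caratheodory.

Section IntegrableR3.
Context {R : realType}.
Local Notation mu := (@lebesgue_measure R).
Local Notation mu3 := ((mu \x mu) \x mu)%E.
Local Notation R1 := (measurableTypeR R).
Local Notation cV3 := 'cV[R]_3.

Let continuous_line (f : cV3 -> R) (x v : cV3) : continuous f ->
  continuous (fun t : R => f (x + t *: v)).
Proof.
move=> cf t; apply: (@continuous_comp _ _ _ (fun t : R => x + t *: v) f).
  apply: (@cvgD _ _ _ _ (nbhs_filter t)); first exact: cvg_cst.
  by apply: (@cvgZr_tmp _ _ _ _ (nbhs_filter t)); exact: cvg_id.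
exact: cf.
Qed.

(** The preceding criterion is applied twice, one coordinate at a time, so that continuity is used
    along coordinate lines only and Borel sets of column vectors are never compared with the product
    sigma-algebra. *)
Lemma continuous_vec3_measurable (f : cV3 -> R) : continuous f ->
  measurable_fun setT (fun y : R1 * R1 * R1 => f (vec3 y)).
Proof.
move=> cf.
have V (a b c : R) : [/\ vec3 (a, b, c) = vec3 (0, b, c) + a *: delta_mx 0 0,
    vec3 (a, b, c) = vec3 (a, 0, c) + b *: delta_mx 1 0 &
    vec3 (a, b, c) = vec3 (a, b, 0) + c *: delta_mx 2 0].
  by split; apply: cV3P; rewrite !mxE /= ?(mulr0, mulr1, addr0, add0r).
apply: (eq_measurable_fun
  (fun z : R1 * R1 * R1 => f (vec3 (z.1.1, z.1.2, z.2)))).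
  by move=> [[a b] c] _.
apply: (@caratheodory_measurable _ _ _ (fun u c => f (vec3 (u.1, u.2, c)))).
  move=> c.
  apply: (@caratheodory_measurable _ _ _ (fun a b => f (vec3 (a, b, c)))).
    move=> b; apply: continuous_measurable_fun.
    under eq_fun do rewrite (let: And3 E _ _ := V _ b c in E).
    exact: continuous_line.
  move=> a; under eq_fun do rewrite (let: And3 _ E _ := V a _ c in E).
  exact: continuous_line.
move=> [a b] /=; under eq_fun do rewrite (let: And3 _ _ E := V a b _ in E).
exact: continuous_line.
Qed.

Lemma integrable_oneDsqrV :
  mu.-integrable setT (EFin \o (fun x : R1 => (oneDsqr x)^-1)).
Proof.
apply/integrableP; split.
  apply/measurable_EFinP.
  by apply: continuous_measurable_fun; exact: continuous_oneDsqrV.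
under eq_integral => x _.
  rewrite /= ger0_norm ?invr_ge0 ?(le_trans _ (oneDsqr_ge1 x))//; over.
rewrite ge0_symfun_integralT//.
- by rewrite -set_itvcy integral0y_oneDsqr -EFinM ltry.
- exact: continuous_oneDsqrV.
- by move=> x; rewrite /oneDsqr /= sqrrN.
Qed.

(** By Tonelli, the iterated integral of the absolute value factors into two finite integrals. *)
Lemma integrable_prodM d1 d2 (T1 : measurableType d1) (T2 : measurableType d2)
    (m1 : {sigma_finite_measure set T1 -> \bar R})
    (m2 : {sigma_finite_measure set T2 -> \bar R}) (f : T1 -> R) (g : T2 -> R) :
  m1.-integrable setT (EFin \o f) -> m2.-integrable setT (EFin \o g) ->
  (m1 \x m2)%E.-integrable setT (EFin \o (fun z => f z.1 * g z.2)).
Proof.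
move=> /integrableP[/measurable_EFinP mf foo].
move=> /integrableP[/measurable_EFinP mg goo].
have mfg : measurable_fun setT (EFin \o (fun z : T1 * T2 => f z.1 * g z.2)).
  apply/measurable_EFinP; apply: measurable_funM.
    by apply: measurableT_comp => //; exact: measurable_fst.
  by apply: measurableT_comp => //; exact: measurable_snd.
apply/(integrable12ltyP _ _ mfg).
have mag : measurable_fun setT (fun y => (`|g y|)%:E).
  by apply/measurable_EFinP; exact: measurableT_comp.
have maf : measurable_fun setT (fun x => (`|f x|)%:E).
  by apply/measurable_EFinP; exact: measurableT_comp.
have ig0 : (0 <= \int[m2]_y (`|g y|)%:E)%E by exact: integral_ge0.
under eq_integral => x _.
  under eq_integral => y _ do rewrite /= normrM EFinM.
  rewrite ge0_integralZl//; over.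
rewrite ge0_integralZr//.
by rewrite lte_mul_pinfty// ?integral_ge0// ge0_fin_numE// integral_ge0.
Qed.

(** The integrand is dominated by a multiple of the product of the three functions 1/(1 + x_i^2).
    The bounded factor [h] makes room for the cosine or sine of a Fourier phase. *)
Lemma schwartz_integrable (f : cV3 -> R) (h : cV3 -> R) : schwartz f ->
  continuous h -> (forall x, `|h x| <= 1) ->
  mu3.-integrable setT (EFin \o (fun y => h (vec3 y) * f (vec3 y))).
Proof.
move=> [sf df] ch h1.
have cf : continuous f by move=> x; have [] := sf [::] x I.
(* The exponents 0, 2, 4, 6 are those in the expansion of (1 + |x|^2)^3, whose coefficients 1, 3, 3,
   1 weight the bounds below. *)
have [C0 H0] := df [::] 0; have [C2 H2] := df [::] 2.
have [C4 H4] := df [::] 4; have [C6 H6] := df [::] 6.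
pose v (x : R) : R := (oneDsqr x)^-1.
have iv2 : (mu \x mu)%E.-integrable setT
  (EFin \o (fun z : R1 * R1 => v z.1 * v z.2)).
  by apply: integrable_prodM; exact: integrable_oneDsqrV.
have iv3 : mu3.-integrable setT
  (EFin \o (fun z : R1 * R1 * R1 => (v z.1.1 * v z.1.2) * v z.2)).
  exact: (@integrable_prodM _ _ _ _ lebesgue2 mu _ _ iv2 integrable_oneDsqrV).
have := integrableZl measurableT (C0 + 3 * C2 + 3 * C4 + C6) iv3.
apply: le_integrable => //.
  apply/measurable_EFinP.
  apply: (@continuous_vec3_measurable (fun x => h x * f x)) => x.
  by apply: continuousM; [exact: ch|exact: cf].
move=> [[a b] c] _.
rewrite -EFinM !abse_EFin lee_fin.
(* The norm of a column vector is the maximum of the absolute values of its entries. *)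
set x := vec3 _; have Nx (i : 'I_3) : x i 0 ^+ 2 <= `|x| ^+ 2.
  rewrite -[leLHS]real_normK ?num_real// ler_sqr ?nnegrE//.
  rewrite [leRHS](mx_normrE x).
  exact: (le_bigmax _ (fun ij => `|x ij.1 ij.2|) (i, 0)).
have [Na Nb Nc] : [/\ a ^+ 2 <= `|x| ^+ 2, b ^+ 2 <= `|x| ^+ 2 &
    c ^+ 2 <= `|x| ^+ 2].
  by have := (Nx 0, Nx 1, Nx 2); rewrite !mxE /= => -[[]].
have pos (t : R) : 0 < oneDsqr t by rewrite (lt_le_trans _ (oneDsqr_ge1 t)).
have P_gt0 : 0 < oneDsqr a * oneDsqr b * oneDsqr c by rewrite !mulr_gt0.
have P_le : oneDsqr a * oneDsqr b * oneDsqr c <= (1 + `|x| ^+ 2) ^+ 3.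
  rewrite exprS expr2 mulrA.
  by rewrite !ler_pM ?mulr_ge0 ?(ltW (pos _))// lerD2l.
have fP : `|f x| * (oneDsqr a * oneDsqr b * oneDsqr c) <=
    C0 + 3 * C2 + 3 * C4 + C6.
  apply: (le_trans (ler_wpM2l (normr_ge0 _) P_le)).
  have -> : `|f x| * (1 + `|x| ^+ 2) ^+ 3 =
      `|x| ^+ 0 * `|f x| + 3 * (`|x| ^+ 2 * `|f x|) +
      3 * (`|x| ^+ 4 * `|f x|) + `|x| ^+ 6 * `|f x| by ring.
  by rewrite !lerD// ?ler_pM2l// ?H0 ?H2 ?H4 ?H6.
apply: (@le_trans _ _ `|f x|).
  by rewrite normrM ler_piMl.
by rewrite (le_trans _ (ler_norm _))// /v -!invfM ler_pdivlMr.
Qed.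

End IntegrableR3.

(** * Covariance of the smearing *)

Section Covariance.
Context {R : realType}.
Local Notation mu := (@lebesgue_measure R).
Local Notation mu3 := ((mu \x mu) \x mu)%E.
Local Notation cV3 := 'cV[R]_3.

Lemma cexpD (z w : R[i]) : cexp (z + w) = cexp z * cexp w.
Proof.
case: z w => [a b] [c d]; rewrite /cexp /= expRD cosD sinD.
by apply/eqP; rewrite eq_complex /=; apply/andP; split; apply/eqP; ring.
Qed.

Lemma cexp_imag (r : R) : cexp ('i * r%:C) = cos r +i* sin r.
Proof.
by rewrite /cexp /= !(mul0r, mul1r, mulr0, addr0, subr0, add0r, oppr0) expR0;
   simpc; rewrite ?mul1r.
Qed.

(** Multiplication by [z] mixes real and imaginary parts; integrability of both lets the resulting
    sums be split. *)
Lemma integral_R3Zl (z : R[i]) (F : cV3 -> R[i]) :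
  mu3.-integrable setT (EFin \o (fun y => complex.Re (F (vec3 y)))) ->
  mu3.-integrable setT (EFin \o (fun y => complex.Im (F (vec3 y)))) ->
  integral_R3 (fun x => z * F x) = z * integral_R3 F.
Proof.
case: z => a b iRe iIm; rewrite /integral_R3 /Cintegral /=.
have iZ r h : mu3.-integrable setT (EFin \o h) ->
    mu3.-integrable setT (EFin \o (fun y => r * h y)).
  by move=> ih; exact: (integrableZl measurableT r ih).
congr (_ +i* _).
- rewrite -!RintegralZl// -RintegralB//; [|exact: iZ|exact: iZ].
  by apply: eq_Rintegral => y _; case: (F _).
- rewrite -!RintegralZl// -RintegralD//; [|exact: iZ|exact: iZ].
  by apply: eq_Rintegral => y _; case: (F _).
Qed.

Lemma dotDr (k x y : cV3) : dot k (x + y) = dot k x + dot k y.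
Proof.
by rewrite /dot -big_split; apply: eq_bigr => i _; rewrite mxE mulrDr.
Qed.

Lemma dotNr (k x : cV3) : dot k (- x) = - dot k x.
Proof. by rewrite /dot -sumrN; apply: eq_bigr => i _; rewrite mxE mulrN. Qed.

Lemma dotE (k x : cV3) : dot k x = (k^T *m x) 0 0.
Proof. by rewrite /dot mxE; apply: eq_bigr => i _; rewrite mxE. Qed.

Lemma dot_mulmx (A : 'M[R]_3) (k x : cV3) : dot (A *m k) x = dot k (A^T *m x).
Proof. by rewrite !dotE trmx_mul mulmxA. Qed.

Lemma continuous_dot (k : cV3) : continuous (dot k).
Proof.
rewrite /dot.
apply: continuous_big => [|i _ x]; first exact: add_continuous.
apply: (@continuousM _ _ (cst (k i 0)) (fun x : cV3 => x i 0)).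
  exact: cst_continuous.
exact: (@coord_continuous R 3 1 i 0 x).
Qed.

Lemma C0S_integrable (f : scalar_field R) (t : R) (h : cV3 -> R) :
  f \in C0S_infty R -> continuous h -> (forall x, `|h x| <= 1) ->
  mu3.-integrable setT (EFin \o (fun y => h (vec3 y) * f (t, vec3 y))).
Proof.
move=> /asboolP[f0 _ _ Sf] ch h1; have [t0|t0] := ltrP 0 t.
  exact: (schwartz_integrable (Sf t t0)).
(* At nonpositive times the integrand vanishes, since fields are extended by zero. *)
rewrite [X in mu3.-integrable _ X](_ : _ = cst 0%E); first exact: integrable0.
apply/funext => y /=; rewrite f0 ?mulr0//.
by apply/negP; rewrite /= -leNgt.
Qed.

Lemma invmx_rot (g : rigid_motion R) : invmx (Defs.rot g) = (Defs.rot g)^T.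
Proof.
by rewrite -[LHS]mulmx1 -(rot_orth g) mulmxA mulVmx ?mul1mx ?rot_unit.
Qed.

Lemma rotTK (g : rigid_motion R) (x : cV3) :
  (Defs.rot g)^T *m (Defs.rot g *m x) = x.
Proof. by rewrite -invmx_rot mulKmx ?rot_unit. Qed.

(** Substituting x = R y + a turns k.x into (R^T k).y + k.a, whose second term is a constant
    phase. *)
Lemma fourier_act (g : rigid_motion R) (f : scalar_field R) (t : R) (k : cV3) :
  axial_motions R g -> f \in C0S_infty R ->
  fourier (act g f) t k =
  cexp ('i * (dot k (trans g))%:C) * fourier f t ((Defs.rot g)^T *m k).
Proof.
move=> ag Cf; rewrite /fourier.
rewrite -(integral_invariant_comp (integral_invariant_translation (trans g))
  (integral_invariant_axial ag)).
rewrite -integral_R3Zl; last 2 first.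
- rewrite [X in mu3.-integrable _ X](_ : _ = EFin \o
     (fun y => cos (dot ((Defs.rot g)^T *m k) (vec3 y)) * f (t, vec3 y))).
    apply: (@C0S_integrable f t
      (fun x => cos (dot ((Defs.rot g)^T *m k) x)) Cf) => [x|x]; last first.
      exact: cos_max.
    by apply: continuous_comp; [exact: continuous_dot|exact: continuous_cos].
  by apply/funext => y; rewrite /comp cexp_imag /= mulr0 subr0.
- rewrite [X in mu3.-integrable _ X](_ : _ = EFin \o
     (fun y => sin (dot ((Defs.rot g)^T *m k) (vec3 y)) * f (t, vec3 y))).
    apply: (@C0S_integrable f t
      (fun x => sin (dot ((Defs.rot g)^T *m k) x)) Cf) => [x|x]; last first.
      exact: sin_max.
    by apply: continuous_comp; [exact: continuous_dot|exact: continuous_sin].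
  by apply/funext => y; rewrite /comp cexp_imag /= mulr0 add0r.
congr integral_R3; apply/funext => x /=.
rewrite mulrA -cexpD -mulrDr -rmorphD /= dotDr dot_mulmx trmxK addrC.
by rewrite /act /inv_motion /= addrK invmx_rot rotTK.
Qed.

(** Replacing k by R k in the inverse transform cancels the R^T of [fourier_act]; the phase from the
    translation combines with exp(-i k.x) to shift x to x - a. *)
Lemma smear_act (lambda : R) (g : rigid_motion R) (f : scalar_field R) :
  axial_motions R g -> f \in C0S_infty R ->
  smear lambda (act g f) = act g (smear lambda f).
Proof.
move=> ag Cf; apply/funext => -[t x].
rewrite -[RHS]/(smear lambda f (inv_motion g (t, x))) /smear.
apply: (congr1 (@complex.Re R)).
rewrite -[LHS](integral_invariant_axial ag).
congr integral_R3; apply/funext => k; apply: (congr1 ( *%R _)).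
rewrite [X in _ * X](fourier_act _ _ ag Cf) rotTK mulrA; congr (_ * _).
have -> : axial_weight lambda (Defs.rot g *m k) = axial_weight lambda k.
  have [c [s [_ ->]]] := axial_rot ag.
  by rewrite /axial_weight !mxE.
rewrite mulrAC -cexpD; congr (cexp _ * _).
rewrite /inv_motion [X in _ = _ * (dot k X)%:C]/= !dot_mulmx invmx_rot.
rewrite mulmxBr dotDr dotNr rmorphB.
by rewrite mulrBr !mulNr opprK.
Qed.

End Covariance.

(** * States on Weyl algebras *)

Section CStarAlgebra.
Context {R : realType} (A : cstarAlgType R).
Implicit Types a b h : A.

Lemma cnorm0 : cnorm (0 : A) = 0.
Proof. by rewrite -(scale0r (0 : A)) cnormZ normr0 mul0r. Qed.

Lemma cnormN a : cnorm (- a) = cnorm a.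
Proof. by rewrite -scaleN1r cnormZ normrN1 mul1r. Qed.

Lemma cnorm_ge0 a : 0 <= cnorm a.
Proof.
have := cnormD a (- a); rewrite subrr cnorm0 cnormN -mulr2n.
by rewrite pmulrn_lge0.
Qed.

Lemma cnormB a b : cnorm (a - b) = cnorm (b - a).
Proof. by rewrite -cnormN opprB. Qed.

Lemma cnorm_distD a b c : cnorm (a - c) <= cnorm (a - b) + cnorm (b - c).
Proof. by rewrite -(subrKA b) cnormD. Qed.

(** By the C*-identity and submultiplicativity, |a|^2 is at most |star a| |a|. *)
Let cnorm_star_le a : cnorm a <= cnorm (star a).
Proof.
have [a0|a0] := leP (cnorm a) 0; first exact: le_trans a0 (cnorm_ge0 _).
by rewrite -(ler_pM2r a0) -expr2 -cnorm_starM cnormM.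
Qed.

Lemma cnorm_star a : cnorm (star a) = cnorm a.
Proof.
apply/eqP; rewrite eq_le cnorm_star_le andbT.
by rewrite -[X in _ <= cnorm X]starK cnorm_star_le.
Qed.

Lemma star0 : star (0 : A) = 0.
Proof. by apply: (addrI (star 0)); rewrite -starD !addr0. Qed.

Lemma starN a : star (- a) = - star a.
Proof. by apply: (addrI (star a)); rewrite -starD !subrr star0. Qed.

Lemma star1 : star (1 : A) = 1.
Proof.
by rewrite -[LHS]mul1r -[X in X * _]starK -starM mul1r starK.
Qed.

Lemma cnormZr (r : R) a : cnorm (r%:C *: a) = `|r| * cnorm a.
Proof. by rewrite cnormZ normc_def /= expr0n addr0 sqrtr_sqr. Qed.

(* [c = 1 - x] for the fixed point [x] of the contraction [x |-> (h + x^2) / 2]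
   of the ball of radius 1/2. *)
Lemma selfadjoint_sqrt h : star h = h -> cnorm h <= 2^-1 ->
  exists c, star c = c /\ c * c = 1 - h.
Proof.
move=> hs hn; pose T x := (2^-1)%:C *: (h + x * x).
have cT a : cnorm ((2^-1 : R)%:C *: a) = 2^-1 * cnorm a.
  by rewrite cnormZr ger0_norm.
pose x n := iter n T 0.
(* The ball is stable because (1/2 + 1/4) / 2 = 3/8. *)
have xn n : cnorm (x n) <= 2^-1.
  elim: n => [|n IH] /=; first by rewrite cnorm0.
  rewrite cT; apply: (@le_trans _ _ (2^-1 * (2^-1 + 2^-1 * 2^-1))); last by lra.
  rewrite ler_pM2l// (le_trans (cnormD _ _))// lerD//.
  by rewrite (le_trans (cnormM _ _))// ler_pM ?cnorm_ge0.
have xs n : star (x n) = x n.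
  elim: n => [|n IH] /=; first exact: star0.
  rewrite starZ starD starM hs IH; congr (_ *: _).
  by apply/eqP; rewrite eq_complex /= oppr0 !eqxx.
(* On the ball, |a^2 - b^2| is at most (|a| + |b|) |a - b|, hence at most |a - b|, even for
   noncommuting a and b. *)
have TE a b : cnorm a <= 2^-1 -> cnorm b <= 2^-1 ->
    cnorm (T a - T b) <= 2^-1 * cnorm (a - b).
  move=> ha hb; rewrite -scalerBr cT ler_pM2l//.
  have -> : h + a * a - (h + b * b) = a * (a - b) + (a - b) * b.
    by rewrite mulrBr mulrBl addrA subrK opprD addrACA subrr add0r.
  rewrite (le_trans (cnormD _ _))//.
  have := cnormM a (a - b); have := cnormM (a - b) b.
  have := cnorm_ge0 (a - b); nra.
have xstep n : cnorm (x n.+1 - x n) <= 2^-1 ^+ n.+1.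
  elim: n => [|n IH].
    rewrite expr1 subr0; exact: xn 1%N.
  by apply: (le_trans (TE _ _ (xn n.+1) (xn n))); rewrite exprS ler_pM2l.
have xdist n m : cnorm (x (n + m)%N - x n) <= 2^-1 ^+ n.
  (* The sharper telescoping bound is the one that passes through the induction on m. *)
  suff : cnorm (x (n + m)%N - x n) <= 2^-1 ^+ n - 2^-1 ^+ (n + m).
    by move=> /le_trans; apply; rewrite gerBl exprn_ge0.
  elim: m => [|m IH]; first by rewrite addn0 !subrr cnorm0.
  rewrite addnS (le_trans (cnorm_distD _ (x (n + m)%N) _))//.
  have := xstep (n + m)%N; rewrite !exprS; lra.
have half_gt0 (e : R) : 0 < e -> 0 < e / 2 by move=> e0; rewrite divr_gt0.
have half_small (e : R) : 0 < e -> exists n, (2^-1 : R) ^+ n < e.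
  move=> e0; have : `|2^-1 : R| < 1 by rewrite ger0_norm// invf_lt1// ltr1n.
  move=> /cvg_expr /cvgrPdist_lt/(_ e e0)[n _ /(_ n (leqnn n))].
  by rewrite sub0r normrN normrX ger0_norm//; exists n.
have [l xl] : exists l, (fun n => cnorm (x n - l)) @ \oo --> (0 : R).
  apply: cnorm_complete => e e0.
  have [n0 Hn0] := half_small (e / 2) (half_gt0 e e0).
  exists n0 => m n mn nn.
  rewrite (le_lt_trans (cnorm_distD _ (x n0) _))// [ltRHS]splitr ltrD//.
    by rewrite -(subnKC mn) (le_lt_trans (xdist _ _)).
  by rewrite cnormB -(subnKC nn) (le_lt_trans (xdist _ _)).
have xlP (e : R) : 0 < e ->
    exists n, cnorm (x n - l) <= e /\ cnorm (x n.+1 - l) <= e.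
  move=> e0; have /cvgrPdist_le/(_ e e0)[n _ Hn] := xl.
  exists n; have := (Hn n (leqnn n), Hn n.+1 (leqnSn n)) => -[].
  by rewrite !sub0r !normrN !ger0_norm ?cnorm_ge0.
have small0 a : (forall e, 0 < e -> cnorm a <= e) -> a = 0.
  move=> Ha; apply: cnorm_eq0; apply/eqP; rewrite eq_le cnorm_ge0 andbT.
  by apply/ler_addgt0Pl => e e0; rewrite addr0 Ha.
have nl : cnorm l <= 2^-1.
  apply/ler_addgt0Pl => e /xlP[n [le_e _]].
  rewrite -[l](subrK (x n)) (le_trans (cnormD _ _))// lerD//.
  by rewrite cnormB.
have sl : star l = l.
  apply: subr0_eq; apply: small0 => e e0.
  have [n [le_e _]] := xlP (e / 2) (half_gt0 e e0).
  rewrite (le_trans (cnorm_distD _ (x n) _))// [leRHS]splitr lerD//.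
  by rewrite cnormB -{1}xs -starN -starD cnorm_star.
have Tl : T l = l.
  apply: subr0_eq; apply: small0 => e e0.
  have [n [le_e le_e']] := xlP (e / 2) (half_gt0 e e0).
  rewrite (le_trans (cnorm_distD _ (x n.+1) _))// [leRHS]splitr lerD//.
  rewrite cnormB (le_trans (TE _ _ (xn n) nl))//.
  by have := cnorm_ge0 (x n - l); lra.
(* This is the fixed point equation; it gives (1 - l)^2 = 1 - 2 l + l^2 = 1 - h. *)
have ll : l * l = l + l - h.
  have : l + l = h + l * l.
    rewrite -{1 2}Tl /T -scalerDl -rmorphD /=.
    by rewrite (_ : 2^-1 + 2^-1 = 1 :> R) ?scale1r//; lra.
  by move=> ->; rewrite addrAC subrr add0r.
exists (1 - l); split; first by rewrite starD starN star1 sl.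
rewrite mulrBr mulr1 mulrBl mul1r ll -[LHS]addrA; congr (1 + _).
by rewrite opprB -!addrA addKr addrC subrK.
Qed.

(** * Boundedness of states *)

Section State.
Variables (o : A -> R[i]) (oP : is_state o).

Lemma stateD a b : o (a + b) = o a + o b.
Proof. by have [lo _ _] := oP; have := lo 1 a b; rewrite !scale1r. Qed.

Lemma state0 : o 0 = 0.
Proof. by apply: (addrI (o 0)); rewrite -stateD !addr0. Qed.

Lemma stateZ (c : R[i]) a : o (c *: a) = c * o a.
Proof.
by have [lo _ _] := oP; have := lo c a 0; rewrite addr0 state0 addr0.
Qed.

Lemma stateB a b : o (a - b) = o a - o b.
Proof. by rewrite stateD -scaleN1r stateZ mulN1r. Qed.

(** Both 1 - h and 1 + h are squares of selfadjoint elements, on which a state is nonnegative. *)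
Let state_selfadjoint h : star h = h -> cnorm h <= 2^-1 -> `|o h| <= 1.
Proof.
have [_ o1 opos] := oP.
have le1 h' : star h' = h' -> cnorm h' <= 2^-1 -> 0 <= 1 - o h'.
  move=> /selfadjoint_sqrt sq /sq[c [cs cc]].
  by rewrite -o1 -stateB -cc -{1}cs opos.
move=> hs hn; have p := le1 _ hs hn.
have := le1 (- h); rewrite starN hs cnormN => /(_ erefl hn).
rewrite -[- h]add0r stateB state0 sub0r opprK => q.
(* Nonnegativity in [R[i]] includes being real. *)
have ohr : o h \is Num.real.
  by rewrite -(subKr 1 (o h)) rpredB ?ger0_real.
rewrite real_ler_norml//; apply/andP; split; last by rewrite -subr_ge0.
by rewrite -[X in X <= _]add0r lerBlDr addrC.
Qed.

(** Dividing by 2 r brings the norm to at most 1/2. The real and imaginary parts h and k then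
    contribute at most 1 each, whence 2 r (1 + 1). The constant need not be sharp for the density
    argument. *)
Lemma state_bounded (r : R) a : 0 < r -> cnorm a <= r -> `|o a| <= (4 * r)%:C.
Proof.
move=> r0 ar; pose b := ((2 * r)^-1)%:C *: a.
have r2 : 0 < 2 * r by rewrite mulr_gt0.
have bn : cnorm b <= 2^-1.
  rewrite cnormZr ger0_norm ?invr_ge0 ?(ltW r2)// ler_pdivrMl//.
  by rewrite mulrAC divff// mul1r.
have aE : a = (2 * r)%:C *: b.
  by rewrite scalerA -rmorphM /= divff ?scale1r// gt_eqF ?mulr_gt0.
clearbody b.
have conjr (s : R) : (s%:C)^*%C = s%:C.
  by apply/eqP; rewrite eq_complex /= oppr0 !eqxx.
pose h := (2^-1 : R)%:C *: (b + star b).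
pose k := (2^-1 : R)%:C *: ('i *: (star b - b)).
have hs : star h = h by rewrite starZ conjr starD starK addrC.
have conji : ('i : R[i])^*%C = - 'i.
  by apply/eqP; rewrite eq_complex /= oppr0 !eqxx.
have ks : star k = k.
  by rewrite !starZ conjr conji starD starN starK scaleNr -scalerN opprB.
have hn : cnorm h <= 2^-1.
  rewrite cnormZr ger0_norm// ler_piMr//.
  by rewrite (le_trans (cnormD _ _))// cnorm_star; move: bn; lra.
have kn : cnorm k <= 2^-1.
  rewrite cnormZr ger0_norm// ler_piMr// cnormZ.
  have -> : complex.Re `|'i : R[i]| = 1.
    by rewrite normc_def /= expr0n expr1n add0r sqrtr1.
  by rewrite mul1r (le_trans (cnormD _ _))// cnormN cnorm_star; move: bn; lra.
have bE : b = h + 'i *: k.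
  have ii : 'i * 'i = -1 :> R[i].
    apply/eqP; rewrite eq_complex /= !(mulr0, mul0r, mulr1, addr0, sub0r).
    by rewrite oppr0 !eqxx.
  have -> : 'i *: k = (2^-1 : R)%:C *: (b - star b).
    rewrite /k scalerA mulrC -scalerA; congr (_ *: _).
    by rewrite scalerA ii scaleN1r opprB.
  rewrite -scalerDr addrACA subrr addr0 scalerDr -scalerDl -rmorphD /=.
  by rewrite (_ : 2^-1 + 2^-1 = 1 :> R) ?scale1r//; lra.
have -> : (4 * r)%:C = (2 * r)%:C * (1 + 1).
  by rewrite mulrDr mulr1 -rmorphD /=; congr (_%:C); ring.
clearbody h k; rewrite aE stateZ normrM bE stateD stateZ ger0_norm; last first.
  by rewrite lecE /= eqxx mulr_ge0// ltW.
rewrite ler_wpM2l//; first by rewrite lecE /= eqxx mulr_ge0// ltW.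
rewrite (le_trans (ler_normD _ _))// lerD ?state_selfadjoint//.
rewrite normrM (_ : `|'i : R[i]| = 1) ?mul1r ?state_selfadjoint//.
by rewrite normc_def /= expr0n expr1n add0r sqrtr1.
Qed.

End State.

(** * States agreeing on Weyl operators *)

Definition lin_comb (V : Type) (W : V -> A) (s : seq (R[i] * V)) : A :=
  \sum_(p <- s) p.1 *: W p.2.

Definition dense_span (V : Type) (W : V -> A) :=
  forall a (e : R), 0 < e -> exists s, cnorm (a - lin_comb W s) <= e.

Lemma states_eq_on_dense_span (V : Type) (W : V -> A) (o o' : A -> R[i]) :
  is_state o -> is_state o' -> dense_span W -> (forall v, o (W v) = o' (W v)) ->
  o =1 o'.
Proof.
move=> so so' dW oW a.
have oLC (q : A -> R[i]) s : is_state q ->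
    q (lin_comb W s) = \sum_(p <- s) p.1 * q (W p.2).
  move=> sq; rewrite /lin_comb.
  elim: s => [|p s IH]; first by rewrite !big_nil (state0 sq).
  by rewrite !big_cons (stateD sq) (stateZ sq) IH.
apply: subr0_eq; apply: normr0_eq0.
set z := o a - o' a; have zr : `|z| = (complex.Re `|z|)%:C.
  by apply/esym/RRe_real; exact: normr_real.
rewrite zr; congr (_%:C); apply/eqP; rewrite eq_le.
have Re0 : 0 <= complex.Re `|z|.
  by have := normr_ge0 z; rewrite {1}zr lecR.
rewrite Re0 andbT; apply/ler_addgt0Pl => e e0; rewrite addr0.
(* By [state_bounded], each of the two states then contributes an error of at most 4 (e / 8) = e /
   2. *)
have e8 : 0 < e / 8 by rewrite divr_gt0.
have [s sa] := dW a _ e8.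
rewrite -lecR -zr.
have -> : z = o (a - lin_comb W s) - o' (a - lin_comb W s).
  rewrite (stateB so) (stateB so') !oLC//.
  under [in RHS]eq_bigr do rewrite oW.
  by rewrite opprB addrA subrK.
rewrite (le_trans (ler_normB _ _))//.
have -> : e%:C = (4 * (e / 8))%:C + (4 * (e / 8))%:C.
  by rewrite -rmorphD /=; congr (_%:C); lra.
by rewrite lerD// state_bounded.
Qed.

Section WeylDense.
Variables (V : lmodType R) (rho : V -> V -> R) (W : V -> A).
Hypothesis weylW : is_weyl_algebra rho W.

Let lin_combZD (c : R[i]) s t :
  exists u, lin_comb W u = c *: lin_comb W s + lin_comb W t.
Proof.
exists ([seq (c * p.1, p.2) | p <- s] ++ t).
rewrite /lin_comb big_cat big_map /= scaler_sumr; congr (_ + _).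
by apply: eq_bigr => p _; rewrite scalerA.
Qed.

Let lin_combM s t : exists u, lin_comb W u = lin_comb W s * lin_comb W t.
Proof.
have [_ _ WM _] := weylW.
exists [seq (p.1 * q.1 * cexp (- 'i%C * (rho p.2 q.2 / 2)%:C), p.2 + q.2)
       | p <- s, q <- t].
rewrite /lin_comb big_allpairs_dep mulr_suml; apply: eq_bigr => p _.
rewrite mulr_sumr; apply: eq_bigr => q _ /=.
by rewrite -[RHS]scalerAl -[in RHS]scalerAr WM !scalerA mulrA.
Qed.

Let lin_comb_star s : exists u, lin_comb W u = star (lin_comb W s).
Proof.
have [_ WN _ _] := weylW.
exists [seq (p.1^*%C, - p.2) | p <- s].
rewrite /lin_comb big_map.
elim: s => [|p s IH]; first by rewrite !big_nil star0.
by rewrite !big_cons starD IH starZ WN.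
Qed.

(** The Weyl relations make the span a star-subalgebra. Its closure [S] is then a closed
    star-subalgebra containing the generators, hence everything. *)
Lemma weyl_dense_span : dense_span W.
Proof.
have [W0 WN WM gW] := weylW.
have half_gt0 (e : R) : 0 < e -> 0 < e / 2 by move=> e0; rewrite divr_gt0.
pose S := [set a : A | forall e : R, 0 < e ->
  exists s, cnorm (a - lin_comb W s) <= e].
have inS s : S (lin_comb W s).
  by move=> e e0; exists s; rewrite subrr cnorm0 ltW.
have SW v : S (W v).
  have := inS [:: (1, v)]; rewrite /lin_comb big_seq1 /= scale1r; exact.
suff ST : S = setT by move=> a; have : S a by rewrite ST.
apply: gW => [||_ [v _ <-]//].
- split; first by rewrite -W0; exact: SW.
  + move=> c a b Sa Sb e e0.
    (* Adding 1 to |c| keeps the divisor positive when c = 0. *)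
    have [n n0 cn] : exists2 n : R, 0 < n &
        forall x : A, cnorm (c *: x) <= n * cnorm x.
      exists (complex.Re `|c| + 1).
        by have := normr_ge0 c; rewrite lecE /= => /andP[_ ?]; rewrite ltr_wpDl.
      by move=> x; rewrite cnormZ mulrDl lerDl mul1r cnorm_ge0.
    have [s Hs] := Sa (e / 2 / n) (divr_gt0 (half_gt0 e e0) n0).
    have [t Ht] := Sb (e / 2) (half_gt0 e e0).
    have [u uE] := lin_combZD c s t; exists u.
    rewrite uE opprD addrACA -scalerBr [leRHS]splitr.
    rewrite (le_trans (cnormD _ _))// lerD//.
    by rewrite (le_trans (cn _))// mulrC -ler_pdivlMr.
  (* The approximation of b is chosen first, as the precision required for a depends on its norm. *)
  + move=> a b Sa Sb e e0.
    have na : 0 < cnorm a + 1 by rewrite ltr_wpDl ?cnorm_ge0.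
    have [t Ht] := Sb (e / 2 / (cnorm a + 1)) (divr_gt0 (half_gt0 e e0) na).
    have nt : 0 < cnorm (lin_comb W t) + 1 by rewrite ltr_wpDl ?cnorm_ge0.
    have [s Hs] := Sa (e / 2 / (cnorm (lin_comb W t) + 1))
      (divr_gt0 (half_gt0 e e0) nt).
    have [u uE] := lin_combM s t; exists u; rewrite uE.
    have -> : a * b - lin_comb W s * lin_comb W t =
        a * (b - lin_comb W t) + (a - lin_comb W s) * lin_comb W t.
      by rewrite mulrBr mulrBl addrA subrK.
    rewrite (le_trans (cnormD _ _))// [leRHS]splitr lerD//.
      rewrite (le_trans (cnormM _ _))//.
      apply: (@le_trans _ _ ((cnorm a + 1) * cnorm (b - lin_comb W t))).
        by rewrite ler_wpM2r ?cnorm_ge0// lerDl.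
      by rewrite mulrC -ler_pdivlMr.
    rewrite (le_trans (cnormM _ _))//.
    apply: (@le_trans _ _
      (cnorm (a - lin_comb W s) * (cnorm (lin_comb W t) + 1))).
      by rewrite ler_wpM2l ?cnorm_ge0// lerDl.
    by rewrite -ler_pdivlMr.
  + move=> a Sa e e0; have [s Hs] := Sa e e0.
    have [u uE] := lin_comb_star s; exists u.
    by rewrite uE -starN -starD cnorm_star.
- move=> u l Su ul e e0.
  have e20 : 0 < e / 2 by rewrite divr_gt0.
  have /cvgrPdist_le/(_ _ e20)[n _ /(_ n (leqnn n)) /=] := ul.
  rewrite sub0r normrN ger0_norm ?cnorm_ge0// => Hn.
  have [s Hs] := Su n _ e20; exists s.
  by rewrite (le_trans (cnorm_distD _ (u n) _))// [leRHS]splitr lerD// cnormB.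
Qed.

End WeylDense.

Lemma states_eq_on_weyl (V : lmodType R) (rho : V -> V -> R) (W : V -> A)
    (o o' : A -> R[i]) : is_weyl_algebra rho W -> is_state o -> is_state o' ->
  (forall v, o (W v) = o' (W v)) -> o =1 o'.
Proof.
by move=> /weyl_dense_span dW so so' oW; exact: states_eq_on_dense_span dW oW.
Qed.

End CStarAlgebra.

(** * Pullback of invariant states *)

Lemma state_comp_morphism (R : realType) (A B : cstarAlgType R) (f : A -> B)
    (o : B -> R[i]) : is_star_morphism f -> is_state o -> is_state (o \o f).
Proof.
move=> [lf [f1 fM] fs] [lo o1 opos]; split.
- by move=> c a b /=; rewrite lf lo.
- by rewrite /= f1.
- by move=> a /=; rewrite fM fs opos.
Qed.

Section StateInvariance.
Context {R : realType}.

(* Both sides are states, so it suffices to compare them on Weyl operators. *)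
Lemma pullback_invariant (G : set (rigid_motion R)) (A B : cstarAlgType R)
    (V V' : lmodType R) (rho : V -> V -> R) (W : V -> A) (W' : V' -> B)
    (T T' : Type) (cls : T -> V) (cls' : T' -> V')
    (act1 : rigid_motion R -> T -> T) (act2 : rigid_motion R -> T' -> T')
    (S : T -> T') (f : A -> B) (beta : rigid_motion R -> A -> A)
    (beta' : rigid_motion R -> B -> B) (o : B -> R[i]) :
  is_weyl_algebra rho W -> (forall v, exists x, v = cls x) ->
  is_star_morphism f -> (forall x, f (W (cls x)) = W' (cls' (S x))) ->
  weyl_action G W cls act1 beta -> weyl_action setT W' cls' act2 beta' ->
  (forall g x, G g -> S (act1 g x) = act2 g (S x)) ->
  is_state o -> invariant_under setT beta' o ->
  invariant_under G beta (o \o f).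
Proof.
move=> weylW clsP fP fW betaP beta'P Sact oP oinv g Gg.
have ofP := state_comp_morphism fP oP.
have [[bP _] bW] := betaP g Gg.
apply: (states_eq_on_weyl weylW (state_comp_morphism bP ofP) ofP) => v.
have [x ->] := clsP v; rewrite /= bW !fW Sact//.
by have [_ <-] := beta'P g I; exact: oinv.
Qed.

End StateInvariance.

Lemma smear_ext_act (R : realType) (lambda xi : R) (E : ext_space lambda xi)
    (g : rigid_motion R) (f : test_function E) : axial_motions R g ->
  smear_ext E (act_ext E g f) = act_ext E g (smear_ext E f).
Proof.
move=> ag; apply: val_inj => /=; apply: (smear_act lambda ag).
exact/ext_C0S_infty/(valP f).
Qed.

Theorem mainTheorem11 (R : realType) (lambda xi : R) (lambda_gt0 : 0 < lambda)
    (E : ext_space lambda xi)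
    (A_star A_ext A_ext_star : cstarAlgType R)
    (W_star : V_star xi -> A_star)
    (W_ext : V_ext E -> A_ext)
    (W_ext_star : V_ext E -> A_ext_star)
    (W_starP : is_weyl_algebra (form_star lambda xi) W_star)
    (W_extP : is_weyl_algebra (form_ext E) W_ext)
    (W_ext_starP : is_weyl_algebra (form_ext_star E) W_ext_star)
    (SS : A_star -> A_ext)
    (SS_morphism : is_star_morphism SS) (SS_inj : injective SS)
    (SS_W : forall f : test_function (Cc_infty R),
       SS (W_star (class_star xi f)) =
       W_ext (class_ext E (smear_ext E (incl_ext E f))))
    (SS_ext : A_ext_star -> A_ext)
    (SS_ext_morphism : is_star_morphism SS_ext) (SS_ext_inj : injective SS_ext)
    (SS_ext_W : forall f : test_function E,
       SS_ext (W_ext_star (class_ext E f)) = W_ext (class_ext E (smear_ext E f)))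
    (beta_star : rigid_motion R -> A_star -> A_star)
    (beta_ext : rigid_motion R -> A_ext -> A_ext)
    (beta_ext_star : rigid_motion R -> A_ext_star -> A_ext_star)
    (beta_starP : weyl_action (axial_motions R) W_star
       (class_star xi) act_Cc beta_star)
    (beta_extP : weyl_action setT W_ext
       (class_ext E) (act_ext E) beta_ext)
    (beta_ext_starP : weyl_action (axial_motions R) W_ext_star
       (class_ext E) (act_ext E) beta_ext_star)
    (Omega_ext : A_ext -> R[i])
    (Omega_ext_state : is_state Omega_ext)
    (Omega_ext_inv : invariant_under setT beta_ext Omega_ext) :
  (is_state (Omega_ext \o SS) /\
   invariant_under (axial_motions R) beta_star (Omega_ext \o SS)) /\
  (is_state (Omega_ext \o SS_ext) /\
   invariant_under (axial_motions R) beta_ext_star (Omega_ext \o SS_ext)).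
Proof.
split; split.
- exact: state_comp_morphism.
- apply: (pullback_invariant (S := fun f => smear_ext E (incl_ext E f))
    W_starP _ SS_morphism SS_W beta_starP beta_extP _ Omega_ext_state
    Omega_ext_inv) => [v|g f ag].
    by exists (repr v); exact/esym/qclass_repr.
  (* The inclusion of compactly supported functions commutes with the action, since the underlying
     functions coincide. *)
  rewrite -smear_ext_act//; congr (smear_ext E _); exact: val_inj.
- exact: state_comp_morphism.
- apply: (pullback_invariant W_ext_starP _ SS_ext_morphism SS_ext_W
    beta_ext_starP beta_extP _ Omega_ext_state Omega_ext_inv) => [v|g f ag].
    by exists (repr v); exact/esym/qclass_repr.
  exact: smear_ext_act.
Qed.
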